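(* Let $\mathcal A$ be a unital C$^*$-algebra and let $z\in\mathcal D=\{a\in\mathcal A:\|a\|<1\}$. Then $$\tfrac12\,\|\log(cr(0,z))\|_{\mathcal B(\ell_z)}=d(0,z),$$ where $\|\cdot\|_{\mathcal B(\ell_z)}$ denotes the norm of operators acting in $\ell_z\subset\mathcal A^2$.
   Context: $\mathcal A^2$ is the right C$^*$-module of columns over $\mathcal A$ with inner product $\langle\mathbf x,\mathbf y\rangle=x_1^*y_1+x_2^*y_2$ and norm $\|\mathbf x\|=\|\langle\mathbf x,\mathbf x\rangle\|^{1/2}$. For $z\in\mathcal D$, $\ell_z=\begin{pmatrix}1\\ z\end{pmatrix}\mathcal A\subset\mathcal A^2$, and $cr(0,z):\ell_z\to\ell_z$ is the module endomorphism $cr(0,z)\left(\begin{pmatrix}1\\ z\end{pmatrix}a\right)=\begin{pmatrix}1\\ z\end{pmatrix}(1+|z|)(1-|z|)^{-1}a$, $a\in\mathcal A$, with $|z|=(z^*z)^{1/2}$. Its logarithm $\log(cr(0,z))$ is the endomorphism $\begin{pmatrix}1\\ z\end{pmatrix}a\mapsto\begin{pmatrix}1\\ z\end{pmatrix}\log\big((1+|z|)(1-|z|)^{-1}\big)a$. The distance $d$ on $\mathcal D$ is the geodesic distance of the Finsler metric on $\mathcal D$ which equals the norm of $\mathcal A$ at $0$ and is invariant under the group $\mathcal U(\theta)$ of invertible $2\times2$ matrices over $\mathcal A$ preserving $\theta(\mathbf x,\mathbf y)=x_1^*y_1-x_2^*y_2$ (acting by $\tilde g\cdot z=(g_{21}+g_{22}z)(g_{11}+g_{12}z)^{-1}$);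 it is known that $d(0,z)=\frac12\log\frac{1+\|z\|}{1-\|z\|}$. *)

(* Defs.v *)
From HB Require Import structures.
From mathcomp Require Import all_boot all_order all_algebra.
From mathcomp Require Import complex.
From mathcomp Require Import all_classical all_reals all_analysis.

Set Implicit Arguments.
Unset Strict Implicit.
Unset Printing Implicit Defensive.

Import Order.TTheory GRing.Theory Num.Theory.
Import numFieldNormedType.Exports.

Local Open Scope classical_set_scope.
Local Open Scope ring_scope.
Local Open Scope complex_scope.

(* A unital C*-algebra over R[i]. The norm takes its values in R[i] (in the
   nonnegative reals), hence the power in cstar_normE is computed in R[i]. *)
Record unitalCstarAlg (R : realType) := UnitalCstarAlg {
  cstar_car : completeNormedModType R[i] ;
  cstar_one : cstar_car ;
  cstar_mul : cstar_car -> cstar_car -> cstar_car ;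
  cstar_star : cstar_car -> cstar_car ;
  cstar_mulA : associative cstar_mul ;
  cstar_mul1x : left_id cstar_one cstar_mul ;
  cstar_mulx1 : right_id cstar_one cstar_mul ;
  cstar_mulDl : left_distributive cstar_mul +%R ;
  cstar_mulDr : right_distributive cstar_mul +%R ;
  cstar_one_neq0 : cstar_one != 0 ;
  cstar_scaleAl : forall (c : R[i]) x y,
    c *: cstar_mul x y = cstar_mul (c *: x) y ;
  cstar_scaleAr : forall (c : R[i]) x y,
    c *: cstar_mul x y = cstar_mul x (c *: y) ;
  cstar_starK : involutive cstar_star ;
  cstar_starD : {morph cstar_star : x y / x + y} ;
  cstar_starZ : forall (c : R[i]) x, cstar_star (c *: x) = c^* *: cstar_star x ;
  cstar_starM : forall x y,
    cstar_star (cstar_mul x y) = cstar_mul (cstar_star y) (cstar_star x) ;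
  cstar_normM : forall x y, `|cstar_mul x y| <= `|x| * `|y| ;
  cstar_normE : forall x, `|cstar_mul (cstar_star x) x| = `|x| ^+ 2
}.

(* The carrier, on which both the normed module structure and the algebra
   structure are declared (the library has no structure joining the two). *)
Definition cstar_sort (R : realType) (A : unitalCstarAlg R) : Type :=
  cstar_car A.
Coercion cstar_sort : unitalCstarAlg >-> Sortclass.

Section Instances.
Context (R : realType) (A : unitalCstarAlg R).

HB.instance Definition _ :=
  CompleteNormedModule.copy (cstar_sort A) (cstar_car A).

HB.instance Definition _ := GRing.Zmodule_isNzRing.Build (cstar_sort A)
  (@cstar_mulA R A) (@cstar_mul1x R A) (@cstar_mulx1 R A)
  (@cstar_mulDl R A) (@cstar_mulDr R A) (@cstar_one_neq0 R A).

HB.instance Definition _ :=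
  GRing.Lmodule_isLalgebra.Build R[i] (cstar_sort A) (@cstar_scaleAl R A).

HB.instance Definition _ :=
  GRing.Lalgebra_isAlgebra.Build R[i] (cstar_sort A) (@cstar_scaleAr R A).

Definition cstar_is_inv (x y : A) : Prop := y * x = 1 /\ x * y = 1.

Definition cstar_unit : {pred A} := fun x => `[< exists y, cstar_is_inv x y >].

Definition cstar_inv (x : A) : A := xget x [set y | cstar_is_inv x y].

Lemma cstar_invP x : x \in cstar_unit -> cstar_is_inv x (cstar_inv x).
Proof. by move=> /asboolP[y xy]; rewrite /cstar_inv; apply: (xgetPex x); exists y. Qed.

Lemma cstar_mulVx : {in cstar_unit, left_inverse 1 cstar_inv *%R}.
Proof. by move=> x /cstar_invP[]. Qed.

Lemma cstar_mulxV : {in cstar_unit, right_inverse 1 cstar_inv *%R}.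
Proof. by move=> x /cstar_invP[]. Qed.

Lemma cstar_unitPl x y : y * x = 1 /\ x * y = 1 -> cstar_unit x.
Proof. by move=> xy; apply/asboolP; exists y. Qed.

Lemma cstar_inv_out : {in [predC cstar_unit], cstar_inv =1 id}.
Proof.
move=> x; rewrite inE => /negP xNu; apply: xgetPN => y xy; apply: xNu.
by apply/asboolP; exists y.
Qed.

HB.instance Definition _ := GRing.NzRing_hasMulInverse.Build (cstar_sort A)
  cstar_mulVx cstar_mulxV cstar_unitPl cstar_inv_out.

Definition star (x : A) : A := cstar_star x.

End Instances.

Section Cstar.
Context {R : realType} {A : unitalCstarAlg R}.
Implicit Types (a z v : A) (g : 'M[A]_2) (x y : 'cV[A]_2).

(* the norm of A, as an element of R *)
Definition rnorm a : R := complex.Re `|a|.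

Definition ball1 : set A := [set a | rnorm a < 1].

Definition spectrum a : set R[i] :=
  [set c | c%:A - a \isn't a GRing.unit].

Definition polyeval (p : {poly R}) a : A :=
  horner_alg a (map_poly (real_complex R) p).

(* Continuous functional calculus for a self-adjoint a (whose spectrum is real)
   and a real function f continuous on the spectrum of a: f(a) is the limit of
   p_n(a) for real polynomials p_n converging to f uniformly on the spectrum. *)
Definition cfc (f : R -> R) a : A :=
  xget 0 [set b | exists p : nat -> {poly R},
    (forall e : R, 0 < e -> \forall n \near \oo,
       forall t : R, spectrum a t%:C -> `|(p n).[t] - f t| <= e) /\
    polyeval (p n) a @[n --> \oo] --> b].

Definition cabs a : A := cfc Num.sqrt (star a * a).

(* A^2, as the right A-module of columns; a scalar a acts by x *m a%:M *)

Definition dot x y : A :=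
  star (x ord0 ord0) * y ord0 ord0 + star (x ord_max ord0) * y ord_max ord0.

Definition colnorm x : R := Num.sqrt (rnorm (dot x x)).

Definition ell_gen z : 'cV[A]_2 := \col_i (if i == ord0 then 1 else z).

Definition ell z : set 'cV[A]_2 := range (fun a => ell_gen z *m a%:M).

(* The endomorphism (1, z) a |-> (1, z) c a of ell z; the coordinate a of an
   element of ell z is its first entry. Endomorphisms of ell z are represented
   by functions on A^2, of which only the values on ell z matter. *)
Definition ell_endo z (c : A) : 'cV[A]_2 -> 'cV[A]_2 :=
  fun x => ell_gen z *m (c * x ord0 ord0)%:M.

Definition cr0 z : 'cV[A]_2 -> 'cV[A]_2 :=
  ell_endo z ((1 + cabs z) * (1 - cabs z)^-1).

(* The logarithm of an endomorphism (1, z) a |-> (1, z) c a, with c positive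
   and invertible, is (1, z) a |-> (1, z) (log c) a; c is the first entry of
   the image of (1, z). *)
Definition log_endo z (T : 'cV[A]_2 -> 'cV[A]_2) : 'cV[A]_2 -> 'cV[A]_2 :=
  ell_endo z (cfc (@ln R) (T (ell_gen z) ord0 ord0)).

Definition ell_opnorm z (T : 'cV[A]_2 -> 'cV[A]_2) : \bar R :=
  ereal_sup [set (colnorm (T x))%:E | x in ell z `&` [set x | colnorm x <= 1]].

Definition theta x y : A :=
  star (x ord0 ord0) * y ord0 ord0 - star (x ord_max ord0) * y ord_max ord0.

Definition Utheta : set 'M[A]_2 :=
  [set g | (exists h : 'M[A]_2, g *m h = 1%:M /\ h *m g = 1%:M) /\
           forall x y, theta (g *m x) (g *m y) = theta x y].

Definition moebius g z : A :=
  (g ord_max ord0 + g ord_max ord_max * z) *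
  (g ord0 ord0 + g ord0 ord_max * z)^-1.

(* F z v is the length of the tangent vector v at the point z of the unit ball.
   As Utheta acts transitively on the ball, these two conditions determine F
   there; its values outside the ball are irrelevant. 'D_v is the derivative
   along v for the complex scalars (moebius g is holomorphic on the ball). *)
Definition is_invariant_Finsler (F : A -> A -> R) : Prop :=
  (forall v, F 0 v = rnorm v) /\
  (forall g z v, Utheta g -> ball1 z ->
     F (moebius g z) ('D_v (moebius g) z) = F z v).

(* Curves in A have a real parameter whereas A is a module over R[i], hence the
   explicit difference quotients. *)
Definition diff_quot (gamma : R -> A) (t h : R) : A :=
  (h^-1)%:C *: (gamma (t + h) - gamma t).

Definition velocity (gamma : R -> A) (t : R) : A :=
  lim (diff_quot gamma t h @[h --> 0^']).

(* C^1 on the closed interval: continuous there, differentiable inside, with a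
   derivative that extends continuously to the end points. *)
Definition C1_on (s t : R) (gamma : R -> A) : Prop :=
  {within `[s, t], continuous gamma} /\
  exists w : R -> A, {within `[s, t], continuous w} /\
    forall u, s < u < t -> diff_quot gamma u h @[h --> 0^'] --> w u.

Definition piecewise_C1 (gamma : R -> A) : Prop :=
  exists (n : nat) (t : nat -> R),
    [/\ t 0%N = 0, t n = 1 &
        forall i, (i < n)%N -> t i < t i.+1 /\ C1_on (t i) (t i.+1) gamma].

Definition ball_curve (z w : A) (gamma : R -> A) : Prop :=
  [/\ piecewise_C1 gamma, gamma 0 = z, gamma 1 = w &
      forall t, 0 <= t <= 1 -> ball1 (gamma t)].

(* The velocity may fail to exist at finitely many points of [0, 1], which do
   not contribute to the integral. *)
Definition curve_length (F : A -> A -> R) (gamma : R -> A) : \bar R :=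
  \int[lebesgue_measure]_(t in `[0, 1]) (F (gamma t) (velocity gamma t))%:E.

Definition geodesic_dist (F : A -> A -> R) (z w : A) : \bar R :=
  ereal_inf [set curve_length F gamma | gamma in ball_curve z w].

End Cstar.

(* Main.v *)
Require Import Defs.
From mathcomp Require Import all_boot all_order all_algebra.
From mathcomp Require Import complex.
From mathcomp Require Import all_classical all_reals all_analysis.
From mathcomp Require Import measurable_realfun ring lra.

Set Implicit Arguments.
Unset Strict Implicit.
Unset Printing Implicit Defensive.

Import Order.TTheory GRing.Theory Num.Theory.
Import numFieldNormedType.Exports.
Local Open Scope classical_set_scope.
Local Open Scope ring_scope.

(** Left side: the coordinate of an element of [ell z] identifies the operator norm
    of the endomorphism [a |-> c a] with the norm of [c] when [c] commutes with
    [z^* z], because [(1, z) a] has norm [|u a|] with [u = sqrt (1 + z^* z)]. So the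
    norm is that of [log ((1 + |z|) / (1 - |z|))], which is [ln ((1 + r) / (1 - r))]
    with [r = |z|], as [r] is the largest point of the spectrum of the absolute value.

    Right side: the element of [Utheta] sending [0] to [z] has derivative
    [w |-> D w E] at [0], where [E = sqrt (1 - z^* z)] and [D = sqrt (1 - z (z^* ))], so
    the Finsler metric is [F z v = |D^-1 v E^-1|]. Along a curve, the upper right
    derivative of [artanh |gamma|] is at most [F gamma gamma'], which bounds lengths
    from below; the segment [t z] has speed at most [r / (1 - t^2 r^2)], whose
    integral is [artanh r]. *)

(** * Norm, involution and inverses *)

(** No Gelfand representation is used. Square roots are norm limits of an explicit polynomial
    iteration, positivity is a norm inequality, and [cfc], which chooses a limit of polynomials, is
    computed by exhibiting polynomials with a uniform rate, once for the square root in [cabs] and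
    once for the logarithm. The one deep algebraic input is that [star z * z] is positive: it gives
    [cabs] its meaning, and the order estimates on both sides of the equality rest on it.

    On the metric side, the norm along a curve need not be differentiable. The lower bound therefore
    uses one-sided estimates with an error [e * h], and a monotonicity lemma of Dini type takes the
    place of integrating a derivative. The function [artanh] enters because a tangent vector of
    Finsler length [k] at [z] makes the norm [r] of [z] grow at rate at most [(1 - r^2) k], and the
    derivative [1 / (1 - r^2)] of [artanh] cancels this factor. *)

Section Norm.
Local Open Scope complex_scope.
Context {R : realType} {A : unitalCstarAlg R}.
Implicit Types (a b x y z w : A) (t k e : R).

Lemma normE x : `|x| = (rnorm x)%:C.
Proof. by rewrite /rnorm RRe_real// ger0_real. Qed.

Lemma rnorm_ge0 x : 0 <= rnorm x.
Proof. by rewrite -ler0c -normE. Qed.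

Lemma rnorm0 : rnorm (0 : A) = 0.
Proof. by rewrite /rnorm normr0. Qed.

Lemma rnorm_eq0 x : (rnorm x == 0) = (x == 0).
Proof. by rewrite -(normr_eq0 x) normE fmorph_eq0. Qed.

Lemma rnormD x y : rnorm (x + y) <= rnorm x + rnorm y.
Proof. by rewrite -lecR rmorphD/= -!normE ler_normD. Qed.

Lemma rnormN x : rnorm (- x) = rnorm x.
Proof. by rewrite /rnorm normrN. Qed.

Lemma rdistrC x y : rnorm (x - y) = rnorm (y - x).
Proof. by rewrite -rnormN opprB. Qed.

Lemma rnorm_distD x y z : rnorm (x - z) <= rnorm (x - y) + rnorm (y - z).
Proof. by have -> : x - z = (x - y) + (y - z); [rewrite addrA subrK | exact: rnormD]. Qed.

Lemma rnorm_le_distD x y : rnorm x <= rnorm y + rnorm (x - y).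
Proof. by rewrite -{1}(subrK y x) addrC; exact: rnormD. Qed.

Lemma rnormZ (c : R[i]) x : rnorm (c *: x) = complex.Re `|c| * rnorm x.
Proof.
rewrite /rnorm normrZ.
by rewrite -(@RRe_real _ `|c|) ?ger0_real// normE -rmorphM.
Qed.

Lemma rnormZr t x : rnorm (t%:C *: x) = `|t| * rnorm x.
Proof. by rewrite rnormZ normc_def/= expr0n addr0 sqrtr_sqr. Qed.

Lemma rnormM x y : rnorm (x * y) <= rnorm x * rnorm y.
Proof. by rewrite -lecR rmorphM/= -!normE; exact: cstar_normM. Qed.

Lemma rnormE x : rnorm (star x * x) = rnorm x ^+ 2.
Proof.
apply: (@complexI R); rewrite rmorphXn/= -!normE; exact: cstar_normE.
Qed.

Lemma starK x : star (star x) = x. Proof. exact: cstar_starK. Qed.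
Lemma starD x y : star (x + y) = star x + star y. Proof. exact: cstar_starD. Qed.
Lemma starM x y : star (x * y) = star y * star x. Proof. exact: cstar_starM. Qed.
Lemma starZ (c : R[i]) x : star (c *: x) = c^* *: star x. Proof. exact: cstar_starZ. Qed.
Lemma starZr t x : star (t%:C *: x) = t%:C *: star x.
Proof. by rewrite starZ; congr (_ *: _); exact: conjc_real. Qed.
Lemma star0 : star (0 : A) = 0.
Proof. by apply: (addrI (star 0)); rewrite -starD !addr0. Qed.
Lemma starN x : star (- x) = - star x.
Proof. by apply/eqP; rewrite -addr_eq0 -starD addNr star0. Qed.
Lemma starB x y : star (x - y) = star x - star y.
Proof. by rewrite starD starN. Qed.
Lemma star1 : star (1 : A) = 1.
Proof. by rewrite -[star 1]mulr1 -{2}(starK 1) -starM mulr1 starK. Qed.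

Lemma rnorm_star x : rnorm (star x) = rnorm x.
Proof.
have H y : rnorm y <= rnorm (star y).
  have [->|y0] := eqVneq y 0; first by rewrite star0.
  have ny : 0 < rnorm y by rewrite lt_def rnorm_eq0 y0 rnorm_ge0.
  by rewrite -(ler_pM2r ny) -expr2 -rnormE rnormM.
by apply/eqP; rewrite eq_le H -{2}(starK x) H.
Qed.

Lemma rnorm1 : rnorm (1 : A) = 1.
Proof.
have n0 : rnorm (1 : A) != 0 by rewrite rnorm_eq0 oner_eq0.
by apply: (mulIf n0); rewrite -expr2 -rnormE star1 !mul1r.
Qed.

Lemma rnormX_le x n : rnorm (x ^+ n) <= rnorm x ^+ n.
Proof.
elim: n => [|n IH]; first by rewrite !expr0 rnorm1.
rewrite !exprS (le_trans (rnormM _ _))// ler_wpM2l// rnorm_ge0//.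
Qed.

(** The radii of the normed module structure are positive elements of [R[i]], hence real; this moves
    every limit argument to [R]. *)
Lemma cvg_rnormP {T : Type} (F : set_system T) {FF : Filter F} (f : T -> A) x :
  f t @[t --> F] --> x <->
  (forall e, 0 < e -> \forall t \near F, rnorm (f t - x) < e).
Proof.
split=> [/cvgrPdistC_lt H e e0|H].
  have := H e%:C; rewrite -[0 < _]/(0%:C < e%:C) ltcR => /(_ e0).
  by apply: filterS => t; rewrite normE ltcR.
apply/cvgrPdistC_lt => e e0.
have er : e = (complex.Re e)%:C by rewrite RRe_real// gtr0_real.
have e1 : 0 < complex.Re e by rewrite -ltcR -er.
by apply: filterS (H _ e1) => t; rewrite normE er ltcR.
Qed.

(** Completeness in a quantitative form: the rate [d] survives in the limit, and the later norm
    bounds are read off from it. *)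
Lemma cauchy_rnorm_cvg (u : nat -> A) (d : nat -> R) :
  d n @[n --> \oo] --> 0 ->
  (forall n m, (n <= m)%N -> rnorm (u m - u n) <= d n) ->
  exists2 x, u n @[n --> \oo] --> x & forall n, rnorm (x - u n) <= d n.
Proof.
move=> d0 ud.
have /cvg_ex[x ux] : cvg (u n @[n --> \oo]).
  apply/cauchy_cvgP/cauchy_ballP => e e0.
  have er : e = (complex.Re e)%:C by rewrite RRe_real// gtr0_real.
  have e1 : 0 < complex.Re e / 2 by rewrite divr_gt0// -ltcR -er.
  have /cvgrPdist_lt/(_ _ e1)[N _ HN] := d0.
  rewrite near_map2; near=> n m.
  rewrite -ball_normE/= normE er ltcR.
  have dN : d N < complex.Re e / 2.
    by have := HN N (leqnn _); rewrite sub0r normrN => /ltr_normlW.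
  have := rnorm_distD (u n) (u N) (u m).
  have Nn : (N <= n)%N by near: n; exists N.
  have Nm : (N <= m)%N by near: m; exists N.
  have := ud N n Nn; have := ud N m Nm; rewrite (rdistrC (u n)) (rdistrC (u N) (u m)).
  lra.
exists x => // n; apply/ler_addgt0Pr => e e0.
move/cvg_rnormP/(_ _ e0) : ux => [N _ HN].
have := HN (maxn n N) (leq_maxr _ _).
have := ud n (maxn n N) (leq_maxl _ _).
have := rnorm_distD x (u (maxn n N)) (u n).
rewrite (rdistrC (u (maxn n N)) x); lra.
Unshelve. all: by end_near. Qed.

Lemma cvg_rnorm {T : Type} (F : set_system T) {FF : Filter F} (f : T -> A) x :
  f t @[t --> F] --> x -> rnorm (f t) @[t --> F] --> rnorm x.
Proof.
move=> /cvg_rnormP fx; apply/cvgrPdist_lt => e e0.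
apply: filterS (fx e e0) => t.
have := rnorm_le_distD (f t) x; have := rnorm_le_distD x (f t).
rewrite (rdistrC x) ltr_norml; lra.
Qed.

Lemma cvg_mul {T : Type} (F : set_system T) {FF : Filter F} (f g : T -> A) x y :
  f t @[t --> F] --> x -> g t @[t --> F] --> y -> f t * g t @[t --> F] --> x * y.
Proof.
move=> fx gy; apply/cvg_rnormP => e e0.
have nf : \forall t \near F, rnorm (f t) < rnorm x + 1.
  move/cvg_rnormP/(_ _ ltr01) : fx; apply: filterS => t.
  by have := rnorm_le_distD (f t) x; lra.
have x1 : 0 < rnorm x + 1 by have := rnorm_ge0 x; lra.
have y1 : 0 < rnorm y + 1 by have := rnorm_ge0 y; lra.
have /cvg_rnormP/(_ _ (divr_gt0 (divr_gt0 e0 (ltr0Sn R 1)) y1)) H1 := fx.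
have /cvg_rnormP/(_ _ (divr_gt0 (divr_gt0 e0 (ltr0Sn R 1)) x1)) H2 := gy.
near=> t.
have -> : f t * g t - x * y = f t * (g t - y) + (f t - x) * y.
  by rewrite mulrBr mulrBl subrKA.
apply: le_lt_trans (rnormD _ _) _.
have a1 : rnorm (f t * (g t - y)) < e / 2.
  apply: (@le_lt_trans _ _ ((rnorm x + 1) * rnorm (g t - y))).
    apply: le_trans (rnormM _ _) _; rewrite ler_wpM2r ?rnorm_ge0// ltW//.
    by near: t.
  rewrite mulrC -ltr_pdivlMr//; near: t; exact: H2.
have a2 : rnorm ((f t - x) * y) <= e / 2.
  apply: (@le_trans _ _ (rnorm (f t - x) * (rnorm y + 1))).
    apply: le_trans (rnormM _ _) _; rewrite ler_wpM2l ?rnorm_ge0//; lra.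
  rewrite -ler_pdivlMr// ltW//; near: t; exact: H1.
lra.
Unshelve. all: by end_near. Qed.

Lemma cvg_uniq {T : Type} (F : set_system T) {PF : ProperFilter F} (f : T -> A) x y :
  f t @[t --> F] --> x -> f t @[t --> F] --> y -> x = y.
Proof. by move=> fx fy; apply: (cvg_unique _ fx fy). Qed.

Lemma cvg_star {T : Type} (F : set_system T) {FF : Filter F} (f : T -> A) x :
  f t @[t --> F] --> x -> star (f t) @[t --> F] --> star x.
Proof.
move=> /cvg_rnormP fx; apply/cvg_rnormP => e e0; apply: filterS (fx _ e0) => t.
by rewrite -starB rnorm_star.
Qed.

Lemma unit_mul2 x y : x * y = 1 -> y * x = 1 -> x \is a GRing.unit.
Proof. by move=> xy yx; apply/unitrP; exists y. Qed.

Lemma inv_mul2 x y : x * y = 1 -> y * x = 1 -> x^-1 = y.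
Proof.
move=> xy yx; have ux := unit_mul2 xy yx.
by apply: (mulrI ux); rewrite mulrV.
Qed.

Lemma starV x : x \is a GRing.unit -> star x^-1 = (star x)^-1.
Proof.
by move=> ux; apply/esym/inv_mul2; rewrite -starM (mulrV, mulVr)// star1.
Qed.

Lemma neumann w : rnorm w < 1 ->
  1 - w \is a GRing.unit /\ rnorm (1 - w)^-1 <= (1 - rnorm w)^-1.
Proof.
move=> w1; set q := rnorm w in w1 *; have q0 : 0 <= q := rnorm_ge0 w.
have q1 : 0 < 1 - q by lra.
pose S n := \sum_(i < n) w ^+ i.
have geo n : \sum_(i < n) q ^+ i = (1 - q ^+ n) / (1 - q).
  have := subrX1 q n; set s := \sum_(i < n) _ => h.
  by apply: (mulIf (lt0r_neq0 q1)); rewrite divfK ?lt0r_neq0//; lra.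
have Snm n m : (n <= m)%N -> rnorm (S m - S n) <= q ^+ n / (1 - q).
  move=> /subnKC <-; rewrite /S big_split_ord/= (addrC (\sum_i _)) addrK.
  have : rnorm (\sum_(i < m - n) w ^+ (n + i)) <= q ^+ n * \sum_(i < m - n) q ^+ i.
    elim/big_ind2 : _ => [|x1 x2 y1 y2 h1 h2|i _].
    - by rewrite rnorm0 mulr0.
    - by rewrite (le_trans (rnormD _ _))// mulrDr lerD.
    - by rewrite -exprD rnormX_le.
  move/le_trans; apply; rewrite ler_wpM2l ?exprn_ge0// geo.
  rewrite ler_piMl//; first by rewrite invr_ge0 ltW.
  by have := exprn_ge0 (m - n) q0; lra.
have qn : q ^+ n / (1 - q) @[n --> \oo] --> 0.
  rewrite -[X in _ --> X](mul0r (1 - q)^-1); apply: cvgMl.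
  by apply: cvg_expr; rewrite ger0_norm.
have [s Ss sS] := cauchy_rnorm_cvg qn Snm.
have comm n : (1 - w) * S n = S n * (1 - w).
  rewrite /S mulr_sumr mulr_suml; apply: eq_bigr => i _.
  by rewrite mulrBl mulrBr mul1r mulr1 -exprS -exprSr.
have SE n : (1 - w) * S n = 1 - w ^+ n.
  by rewrite -opprB mulNr -subrX1 opprB.
have H0 : (1 - w) * S n @[n --> \oo] --> (1 : A).
  apply/cvg_rnormP => e e0.
  have /cvgrPdist_lt/(_ _ e0) : q ^+ n @[n --> \oo] --> 0.
    by apply: cvg_expr; rewrite ger0_norm.
  apply: filterS => n; rewrite sub0r normrN ger0_norm ?exprn_ge0// => h.
  by rewrite SE rdistrC opprB subrKC (le_lt_trans (rnormX_le _ _)).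
have H1 : (1 - w) * S n @[n --> \oo] --> ((1 - w) * s : A).
  exact: cvg_mul (cvg_cst _) Ss.
have H2 : (1 - w) * S n @[n --> \oo] --> (s * (1 - w) : A).
  by under eq_fun do rewrite comm; apply: cvg_mul Ss (cvg_cst _).
have E1 : (1 - w) * s = 1 by exact: (cvg_uniq H1 H0).
have E2 : s * (1 - w) = 1 by exact: (cvg_uniq H2 H0).
split; first exact: unit_mul2 E1 E2.
rewrite (inv_mul2 E1 E2).
(* As [S 0 = 0], the error bound at rank 0 is the desired bound on the inverse. *)
by have := sS 0%N; rewrite /S big_ord0 subr0 expr0 mul1r.
Qed.

(** Here [y = x (1 - w)] with [w] of norm at most 1/2, and the difference of inverses is
    [(1 - w)^-1 w x^-1]; the constant 2 bounds the first factor. *)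
Lemma unit_near x y : x \is a GRing.unit -> rnorm x^-1 * rnorm (y - x) <= 2^-1 ->
  y \is a GRing.unit /\ rnorm (y^-1 - x^-1) <= 2 * rnorm x^-1 ^+ 2 * rnorm (y - x).
Proof.
move=> ux h; set w := x^-1 * (x - y).
have w2 : rnorm w <= 2^-1 by rewrite (le_trans (rnormM _ _))// rdistrC.
have w1 : rnorm w < 1 by lra.
have [uw nw] := neumann w1.
have yE : y = x * (1 - w) by rewrite mulrBr mulr1 mulVKr// subKr.
have uy : y \is a GRing.unit by rewrite yE unitrMl.
split => //.
have nwx : rnorm w <= rnorm x^-1 * rnorm (y - x) by rewrite rdistrC rnormM.
clearbody w; have -> : y^-1 - x^-1 = (1 - w)^-1 * w * x^-1.
  apply: (mulrI uy); rewrite mulrBr mulrV// yE !mulrA.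
  by rewrite mulrK// mulrBr mulr1 mulrBl mulrV// opprB subrKC.
have n2 : rnorm (1 - w)^-1 <= 2.
  by rewrite (le_trans nw)// -[leRHS]invrK lef_pV2 ?posrE; lra.
have k0 := rnorm_ge0 x^-1; have w0 := rnorm_ge0 w.
apply: le_trans (rnormM _ _) _.
apply: (@le_trans _ _ (2 * rnorm w * rnorm x^-1)).
  by rewrite ler_wpM2r// (le_trans (rnormM _ _))// ler_wpM2r.
by rewrite expr2; nra.
Qed.

Lemma cvg_inv {T : Type} (F : set_system T) {FF : Filter F} (f : T -> A) x :
  x \is a GRing.unit -> f t @[t --> F] --> x ->
  (\forall t \near F, f t \is a GRing.unit) /\ (f t)^-1 @[t --> F] --> x^-1.
Proof.
move=> ux /cvg_rnormP fx.
set k := rnorm x^-1; have k0 : 0 <= k := rnorm_ge0 _.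
have k1 : 0 < k + 1 by lra.
have h1 : \forall t \near F, k * rnorm (f t - x) <= 2^-1.
  have c0 : 0 < 2^-1 / (k + 1) by rewrite divr_gt0.
  apply: filterS (fx _ c0) => t; rewrite ltr_pdivlMr// => h.
  by have := rnorm_ge0 (f t - x); nra.
split; first by apply: filterS h1 => t /(unit_near ux)[].
apply/cvg_rnormP => e e0.
have c0 : 0 < e / (2 * k ^+ 2 + 1) by rewrite divr_gt0//; nra.
have h2 := fx _ c0; near=> t.
have [_] : f t \is a GRing.unit /\
  rnorm ((f t)^-1 - x^-1) <= 2 * k ^+ 2 * rnorm (f t - x).
  by apply: unit_near => //; near: t.
move/le_lt_trans; apply.
have : rnorm (f t - x) < e / (2 * k ^+ 2 + 1) by near: t.
rewrite ltr_pdivlMr; last by nra.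
by have := rnorm_ge0 (f t - x); nra.
Unshelve. all: by end_near. Qed.

End Norm.

(** * Real polynomials in an element, and square roots *)

Section PolyEval.
Local Open Scope complex_scope.
Context {R : realType} {A : unitalCstarAlg R}.
Implicit Types (a b x y z w : A) (t k e : R) (p q : {poly R}).

Lemma polyevalD p q a : polyeval (p + q) a = polyeval p a + polyeval q a.
Proof. by rewrite /polyeval !rmorphD. Qed.
Lemma polyevalB p q a : polyeval (p - q) a = polyeval p a - polyeval q a.
Proof. by rewrite /polyeval !rmorphB. Qed.
Lemma polyevalM p q a : polyeval (p * q) a = polyeval p a * polyeval q a.
Proof. by rewrite /polyeval !rmorphM. Qed.
Lemma polyevalC t a : polyeval t%:P a = t%:C%:A.
Proof. by rewrite /polyeval map_polyC/= horner_algC. Qed.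
Lemma polyeval0 a : polyeval 0 a = 0.
Proof. by rewrite /polyeval !rmorph0. Qed.
Lemma polyeval1 a : polyeval 1 a = 1.
Proof. by rewrite /polyeval !rmorph1. Qed.
Lemma polyevalX a : polyeval 'X a = a.
Proof. by rewrite /polyeval map_polyX horner_algX. Qed.
Lemma polyevalZ t p a : polyeval (t *: p) a = t%:C *: polyeval p a.
Proof. by rewrite -mul_polyC polyevalM polyevalC mulr_algl. Qed.

Lemma polyeval_sum I r (P : pred I) (E : I -> {poly R}) a :
  polyeval (\sum_(i <- r | P i) E i) a = \sum_(i <- r | P i) polyeval (E i) a.
Proof. by rewrite /polyeval !rmorph_sum. Qed.

Lemma polyevalXn n a : polyeval 'X^n a = a ^+ n.
Proof. by elim: n => [|n IH]; rewrite ?expr0 ?polyeval1// !exprS polyevalM polyevalX IH. Qed.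

Lemma polyevalE p a : polyeval p a = \sum_(i < size p) (p`_i)%:C *: a ^+ i.
Proof.
rewrite -{1}[p]coefK poly_def polyeval_sum.
by apply: eq_bigr => i _; rewrite polyevalZ polyevalXn.
Qed.

Lemma polyeval_comp p q a : polyeval (p \Po q) a = polyeval p (polyeval q a).
Proof.
elim/poly_ind: p => [|p c IH]; first by rewrite comp_poly0 !polyeval0.
by rewrite comp_polyD comp_polyM comp_polyC comp_polyX !polyevalD !polyevalM
  !polyevalC polyevalX IH.
Qed.

(** Two elements [a] and [b] are allowed because the main use is [a = star z * z] and
    [b = z * star z]; the case [a = b] gives commutation. *)
Lemma polyeval_intertwine p z a b : z * a = b * z ->
  z * polyeval p a = polyeval p b * z.
Proof.
move=> h; elim/poly_ind: p => [|p c IH]; first by rewrite !polyeval0 mulr0 mul0r.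
rewrite !polyevalD !polyevalM !polyevalC !polyevalX mulrDr mulrDl.
by rewrite mulrA IH -!mulrA h mulr_algr mulr_algl.
Qed.

Lemma star_polyeval p a : star (polyeval p a) = polyeval p (star a).
Proof.
elim/poly_ind: p => [|p c IH]; first by rewrite !polyeval0 star0.
rewrite !polyevalD !polyevalM !polyevalC !polyevalX starD starM IH.
by rewrite starZr star1 (polyeval_intertwine p (erefl (star a * star a))).
Qed.

Lemma rnorm_polyeval_nneg p a k : (forall i, 0 <= p`_i) -> rnorm a <= k ->
  rnorm (polyeval p a) <= p.[k].
Proof.
move=> p0 ak; rewrite polyevalE horner_coef.
elim/big_ind2 : _ => [|x1 x2 y1 y2 h1 h2|i _].
- by rewrite rnorm0.
- by rewrite (le_trans (rnormD _ _))// lerD.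
rewrite rnormZr ger0_norm// ler_wpM2l// (le_trans (rnormX_le _ _))//.
by rewrite lerXn2r// nnegrE ?(le_trans _ ak) ?rnorm_ge0.
Qed.

Lemma cvg_polyeval {T : Type} (F : set_system T) {FF : Filter F} p (f : T -> A) a :
  f t @[t --> F] --> a -> polyeval p (f t) @[t --> F] --> polyeval p a.
Proof.
move=> fa; elim/poly_ind: p => [|p c IH].
  by under eq_fun do rewrite polyeval0; rewrite polyeval0; exact: cvg_cst.
under eq_fun do rewrite polyevalD polyevalM polyevalC polyevalX.
rewrite polyevalD polyevalM polyevalC polyevalX.
by apply: cvgD (cvg_cst _); apply: cvg_mul.
Qed.

End PolyEval.

(** * Polynomials approximating 1 - sqrt (1 - x) *)

Section SqrtPoly.
Context {R : realType}.
Implicit Types (x : R).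

(* Visser's iteration: with limit y = (x + y^2) / 2, i.e. (1 - y)^2 = 1 - x. *)
Fixpoint visser (n : nat) : {poly R} :=
  if n is m.+1 then 2^-1 *: ('X + visser m ^+ 2) else 0.

Lemma coef_mul_ge0 (p q : {poly R}) : (forall i, 0 <= p`_i) -> (forall i, 0 <= q`_i) ->
  forall i, 0 <= (p * q)`_i.
Proof. by move=> p0 q0 i; rewrite coefM sumr_ge0// => j _; rewrite mulr_ge0. Qed.

Lemma visser_ge0 n i : 0 <= (visser n)`_i.
Proof.
elim: n i => [|n IH] i /=; first by rewrite coef0.
rewrite coefZ coefD coefX mulr_ge0 ?invr_ge0// addr_ge0 ?ler0n//.
exact: coef_mul_ge0.
Qed.

(** Consecutive differences satisfy [2 (y'' - y') = (y' - y) (y' + y)], so nonnegativity of the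
    coefficients is inherited. It reduces convergence at any [w] of norm at most 1 to convergence of
    the real sequence at [x = 1]. *)
Lemma visserB_ge0 n m i : (n <= m)%N -> 0 <= (visser m - visser n)`_i.
Proof.
move=> /subnKC <-; elim: (m - n)%N i => [|k IH] i.
  by rewrite addn0 subrr coef0.
rewrite addnS -(subrK (visser (n + k)) (visser _.+1)) -addrA coefD addr_ge0//.
elim: (n + k)%N i {IH} => [|l IH] i; first by rewrite subr0 visser_ge0.
have -> : visser l.+2 - visser l.+1 =
    2^-1 *: ((visser l.+1 - visser l) * (visser l.+1 + visser l)).
  by rewrite -subr_sqr /= -scalerBr; congr (_ *: _);
    rewrite [in LHS]opprD addrACA subrr add0r.
rewrite coefZ mulr_ge0 ?invr_ge0//; apply: coef_mul_ge0 => // j.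
by rewrite coefD addr_ge0// visser_ge0.
Qed.

Lemma visser_bound n x : 0 <= x <= 1 ->
  [/\ 0 <= (visser n).[x], (visser n).[x] <= 1 - Num.sqrt (1 - x) &
      1 - Num.sqrt (1 - x) - (visser n).[x] <= 2 / n.+1%:R].
Proof.
move=> /andP[x0 x1]; set s := Num.sqrt (1 - x).
have s0 : 0 <= s := sqrtr_ge0 _.
have s2 : s ^+ 2 = 1 - x by rewrite sqr_sqrtr// subr_ge0.
have s1 : s <= 1 by nra.
(* The induction runs with [n + 2] in the denominator: at rank 0 the bound is then 1, and the
   recursion [d' <= d - d^2 / 2] preserves it. *)
suff [h0 h1 h2] : [/\ 0 <= (visser n).[x], (visser n).[x] <= 1 - s &
    1 - s - (visser n).[x] <= 2 / n.+2%:R].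
  split => //; apply: (le_trans h2); rewrite ler_wpM2l// lef_pV2 ?posrE//.
  by rewrite ler_nat.
elim: n => [|n [h0 h1 h2]] /=.
  by rewrite horner0 divff//; split; lra.
rewrite hornerE/= hornerD hornerX horner_exp; set y := (visser n).[x] in h0 h1 h2 *.
split; [nra|nra|].
have -> : 1 - s - 2^-1 * (x + y ^+ 2) = (1 - s - y) * (1 - s + y) / 2.
  have -> : x = 1 - s ^+ 2 by rewrite s2; lra.
  by field.
set d := 1 - s - y in h2 *.
set N : R := n.+3%:R; have N2 : 2 < N by rewrite ltr_nat.
have NE : n.+2%:R = N - 1 by rewrite /N -[n.+3%:R]natr1 addrK.
have d0 : 0 <= d by rewrite /d; lra.
apply: (@le_trans _ _ (d - d ^+ 2 / 2)); first by rewrite /d; nra.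
rewrite NE in h2.
set u := 2 / (N - 1) in h2.
have uE : u * (N - 1) = 2 by rewrite divfK//; lra.
(* The map [x - x^2 / 2] respects [d <= u] when [u + d <= 2], and [u - u^2 / 2 <= 2 / N] because
   [N (N - 2) <= (N - 1)^2]. *)
have u2 : u <= 2 - d; last first.
  apply: (@le_trans _ _ (u - u ^+ 2 / 2)); first by nra.
  rewrite ler_pdivlMr; last by lra.
  by nra.
have : u <= 1 by rewrite /u ler_pdivrMr; [rewrite -[N - 1]NE; rewrite mul1r ler_nat|lra].
by rewrite /d; lra.
Qed.

End SqrtPoly.

(** * Square roots and positive elements *)

Section Sqrt.
Local Open Scope complex_scope.
Context {R : realType} {A : unitalCstarAlg R}.
Implicit Types (a b h u x y z w : A) (t k e : R) (p q : {poly R}).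

Definition sc t : A := t%:C%:A.

Lemma scD t k : sc (t + k) = sc t + sc k.
Proof. by rewrite /sc rmorphD scalerDl. Qed.
Lemma scN t : sc (- t) = - sc t.
Proof. by rewrite /sc rmorphN scaleNr. Qed.
Lemma scB t k : sc (t - k) = sc t - sc k.
Proof. by rewrite scD scN. Qed.
Lemma sc_mul t x : sc t * x = t%:C *: x.
Proof. exact: mulr_algl. Qed.
Lemma mul_sc t x : x * sc t = t%:C *: x.
Proof. exact: mulr_algr. Qed.
Lemma scM t k : sc (t * k) = sc t * sc k.
Proof. by rewrite sc_mul /sc rmorphM scalerA. Qed.
Lemma sc_comm t x : sc t * x = x * sc t.
Proof. by rewrite sc_mul mul_sc. Qed.
Lemma sc0 : sc 0 = 0. Proof. exact: scale0r. Qed.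
Lemma sc1 : sc 1 = 1. Proof. exact: scale1r. Qed.
Lemma star_sc t : star (sc t) = sc t.
Proof. by rewrite /sc starZr star1. Qed.
Lemma rnorm_sc t : rnorm (sc t) = `|t|.
Proof. by rewrite /sc rnormZr rnorm1 mulr1. Qed.
Lemma sc_unit t : t != 0 -> sc t \is a GRing.unit.
Proof.
by move=> t0; apply: (@unit_mul2 _ _ _ (sc t^-1));
  rewrite -scM ?mulfV ?mulVf ?sc1.
Qed.
Lemma half_add x y : x = (2^-1)%:C *: y -> x + x = y.
Proof.
move=> ->; rewrite -scalerDl -rmorphD.
by have -> : 2^-1 + 2^-1 = 1 :> R; [lra | rewrite rmorph1 scale1r].
Qed.

Lemma half_addE x : (2^-1)%:C *: (x + x) = x.
Proof. by rewrite scalerDr; exact: half_add. Qed.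

Lemma visser_cauchy w : rnorm w <= 1 -> forall n m, (n <= m)%N ->
  rnorm (polyeval (visser m) w - polyeval (visser n) w) <= 2 / n.+1%:R.
Proof.
move=> w1 n m nm; rewrite -polyevalB.
apply: le_trans (rnorm_polyeval_nneg _ w1) _; first by move=> i; exact: visserB_ge0.
have h11 : 0 <= (1 : R) <= 1 by rewrite ler01 lexx.
rewrite hornerD hornerN.
have [] := visser_bound n h11; have [] := visser_bound m h11.
rewrite subrr sqrtr0 subr0 => _ h1 _ _ _ h2; exact: le_trans (lerB h1 (lexx _)) h2.
Qed.

Lemma cvg_2harmonic : 2 / n.+1%:R @[n --> \oo] --> (0 : R).
Proof.
rewrite -[X in _ --> X](mulr0 2); apply: cvgMr; exact: cvg_harmonic.
Qed.

Definition visser_lim w : A := lim (polyeval (visser n) w @[n --> \oo]).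

Lemma visser_cvg w : rnorm w <= 1 ->
  polyeval (visser n) w @[n --> \oo] --> visser_lim w /\
  forall n, rnorm (visser_lim w - polyeval (visser n) w) <= 2 / n.+1%:R.
Proof.
move=> w1; have [x ux xu] := cauchy_rnorm_cvg cvg_2harmonic (visser_cauchy w1).
have -> : visser_lim w = x by exact/cvg_lim.
by [].
Qed.

Definition sqrt1m w : A := 1 - visser_lim w.

Lemma sqrt1m_sqr w : rnorm w <= 1 -> sqrt1m w * sqrt1m w = 1 - w.
Proof.
move=> w1; rewrite /sqrt1m; set y := visser_lim w.
have [yc _] := visser_cvg w1; rewrite -/y in yc.
have H1 : polyeval (visser n.+1) w @[n --> \oo] --> y by move: yc; rewrite -cvg_shiftS.
have H2 : polyeval (visser n.+1) w @[n --> \oo] --> (2^-1)%:C *: (w + y * y).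
  under eq_fun do rewrite /= polyevalZ polyevalD polyevalX expr2 polyevalM.
  by apply: cvgZr; apply: cvgD (cvg_cst _) _; apply: cvg_mul.
have E : y = (2^-1)%:C *: (w + y * y) by exact: cvg_uniq H1 H2.
have {}E := half_add E.
have -> : w = y + y - y * y by rewrite E addrK.
rewrite mulrBr mulr1 mulrBl mul1r !opprB opprD -!addrA.
by congr (1 + _); rewrite addrCA.
Qed.

Lemma sqrt1m_intertwine z a b : rnorm a <= 1 -> rnorm b <= 1 ->
  z * a = b * z -> z * sqrt1m a = sqrt1m b * z.
Proof.
move=> a1 b1 h; rewrite /sqrt1m mulrBr mulrBl mulr1 mul1r; congr (_ - _).
have [ac _] := visser_cvg a1; have [bc _] := visser_cvg b1.
apply: (cvg_uniq (cvg_mul (cvg_cst z) ac)).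
under eq_fun do rewrite (polyeval_intertwine _ h).
exact: cvg_mul bc (cvg_cst z).
Qed.

Lemma star_sqrt1m w : rnorm w <= 1 -> star w = w -> star (sqrt1m w) = sqrt1m w.
Proof.
move=> w1 ws; rewrite /sqrt1m starB star1; congr (_ - _).
have [wc _] := visser_cvg w1.
apply: (cvg_uniq (cvg_star wc)).
by under eq_fun do rewrite star_polyeval ws.
Qed.

Lemma rnorm_visser_lim w : rnorm w <= 1 -> rnorm (visser_lim w) <= 1.
Proof.
move=> w1; have [wc _] := visser_cvg w1.
apply: (cvgr_to_le (cvg_rnorm wc)).
near=> n; apply: le_trans (rnorm_polyeval_nneg _ w1) _; first exact: visser_ge0.
have h11 : 0 <= (1 : R) <= 1 by rewrite ler01 lexx.
by have [_ + _] := visser_bound n h11; rewrite subrr sqrtr0 subr0.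
Unshelve. all: by end_near. Qed.

(** The rate of [visser_cvg] does not depend on [w], so [sqrt1m] is a uniform limit of polynomials
    on the closed unit ball, and an [e / 3] argument applies. *)
Lemma cvg_sqrt1m {T : Type} (F : set_system T) {FF : Filter F} (f : T -> A) w :
  (\forall t \near F, rnorm (f t) <= 1) -> rnorm w <= 1 ->
  f t @[t --> F] --> w -> sqrt1m (f t) @[t --> F] --> sqrt1m w.
Proof.
move=> f1 w1 fw; apply/cvg_rnormP => e e0.
have e3 : 0 < e / 3 by lra.
have /cvgrPdist_lt/(_ _ e3)[N _ HN] := cvg_2harmonic.
have {HN} := HN N (leqnn _); rewrite sub0r normrN => /ltr_normlW HN.
have fy : polyeval (visser N) (f t) @[t --> F] --> polyeval (visser N) w.
  exact: cvg_polyeval.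
have /cvg_rnormP/(_ _ e3) H := fy. near=> t.
have h1 : rnorm (f t) <= 1 by near: t.
have h2 : rnorm (polyeval (visser N) (f t) - polyeval (visser N) w) < e / 3 by near: t.
have [_ /(_ N) h3] := visser_cvg h1; have [_ /(_ N) h4] := visser_cvg w1.
have -> : sqrt1m (f t) - sqrt1m w = visser_lim w - visser_lim (f t).
  by rewrite /sqrt1m opprB addrC subrKA.
move/le_lt_trans: h3 => /(_ _ HN) h3; move/le_lt_trans: h4 => /(_ _ HN) h4.
have := rnorm_distD (visser_lim w) (polyeval (visser N) w) (visser_lim (f t)).
have := rnorm_distD (polyeval (visser N) w) (polyeval (visser N) (f t)) (visser_lim (f t)).
rewrite (rdistrC (polyeval (visser N) w) (polyeval (visser N) (f t))).
rewrite (rdistrC (polyeval (visser N) (f t)) (visser_lim (f t))).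
lra.
Unshelve. all: by end_near. Qed.

(* Kelley and Vaught's norm characterization of positivity: it makes sums of
   positive elements positive without any spectral theory. *)
Definition pos h : Prop := star h = h /\ exists k, rnorm (sc k - h) <= k.

Lemma pos_bound h k : 0 <= k -> star h = h -> rnorm (sc k - h) <= k -> pos h.
Proof. by move=> k0 sh hk; split=> //; exists k. Qed.

Lemma posD h x : pos h -> pos x -> pos (h + x).
Proof.
move=> [sh [k hk]] [sx [m xm]]; split; first by rewrite starD sh sx.
exists (k + m); rewrite scD opprD addrACA (le_trans (rnormD _ _))//; lra.
Qed.

Lemma posZ t h : 0 <= t -> pos h -> pos (t%:C *: h).
Proof.
move=> t0 [sh [k hk]]; split; first by rewrite starZr sh.
exists (t * k); rewrite scM sc_mul -scalerBr rnormZr ger0_norm//.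
by rewrite ler_wpM2l.
Qed.

Lemma pos_sc t : 0 <= t -> pos (sc t).
Proof.
by move=> t0; split; [exact: star_sc|exists t; rewrite subrr rnorm0].
Qed.

Lemma pos_scB h k : star h = h -> rnorm h <= k -> pos (sc k - h).
Proof.
by move=> sh hk; split; [rewrite starB star_sc sh|exists k; rewrite subKr].
Qed.

Lemma rnorm_sqr_sa x : star x = x -> rnorm (x * x) = rnorm x ^+ 2.
Proof. by move=> sx; rewrite -rnormE sx. Qed.

(* [x^2 + y^2 = c^* c] with [c = x + i y], and [x] is the real part of [c]. *)
Lemma rnorm_sqrD_ge x y : star x = x -> star y = y -> x * y = y * x ->
  rnorm (x * x) <= rnorm (x * x + y * y).
Proof.
move=> sx sy xy; pose c := x + 'i%C *: y.
have sc' : star c = x - 'i%C *: y.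
  rewrite starD starZ sx sy -scaleNr; congr (_ + _ *: _).
  by apply/eqP; rewrite eq_complex /= oppr0 !eqxx.
have i2 : 'i%C * 'i%C = -1 :> R[i] by rewrite -expr2 sqr_i.
have -> : x * x + y * y = star c * c.
  rewrite sc' mulrBl !mulrDr -!scalerAr -!scalerAl scalerA i2 scaleN1r.
  by rewrite xy addrKA opprK.
rewrite rnormE rnorm_sqr_sa// lerXn2r ?nnegrE ?rnorm_ge0//.
have -> : x = (2^-1)%:C *: (c + star c).
  by rewrite sc' /c addrACA subrr addr0 half_addE.
rewrite rnormZr ger0_norm ?invr_ge0// ler_pdivrMl// mulr_natl mulr2n.
by rewrite (le_trans (rnormD _ _))// rnorm_star.
Qed.

(** After scaling to norm at most 1, [s = sqrt1m (y * y)] is self-adjoint, commutes with [y] and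
    satisfies [s^2 + y^2 = 1]. Hence [1 - y^2 = s^2] has norm at most 1, which is positivity with
    constant 1. *)
Lemma pos_sqr x : star x = x -> pos (x * x).
Proof.
move=> sx; have [->|x0] := eqVneq x 0.
  by rewrite mulr0 -sc0; exact: pos_sc.
have nx : 0 < rnorm x by rewrite lt_def rnorm_eq0 x0 rnorm_ge0.
pose y := (rnorm x)^-1%:C *: x.
have sy : star y = y by rewrite starZr sx.
have ny : rnorm (y * y) <= 1.
  rewrite rnorm_sqr_sa// rnormZr ger0_norm ?invr_ge0 ?(ltW nx)//.
  by rewrite mulVf ?gt_eqF// expr1n.
have xE : x = (rnorm x)%:C *: y.
  by rewrite /y scalerA -rmorphM mulfV ?gt_eqF// rmorph1 scale1r.
have -> : x * x = (rnorm x ^+ 2)%:C *: (y * y).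
  by rewrite {1 2}xE -scalerAl -scalerAr scalerA -rmorphM -expr2.
apply: posZ; first by rewrite exprn_ge0// ltW.
split; first by rewrite starM sy.
exists 1; rewrite sc1 -sqrt1m_sqr//; set s := sqrt1m _.
have ss : star s = s by rewrite star_sqrt1m// starM sy.
have sy' : s * y = y * s by rewrite -(@sqrt1m_intertwine y (y * y) (y * y))// mulrA.
have := rnorm_sqrD_ge ss sy sy'.
by rewrite sqrt1m_sqr// subrK rnorm1.
Qed.

(** If [k - h] has norm at most [k > 0], then [w = 1 - h / k] lies in the domain of [sqrt1m], and
    the root is [sqrt k] times [sqrt1m w]. The last clause is what makes roots of commuting elements
    commute. *)
Lemma pos_sqrt h : pos h -> exists u,
  [/\ pos u, u * u = h & forall c, c * h = h * c -> c * u = u * c].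
Proof.
move=> [sh [k hk]].
have : 0 <= k by exact: le_trans (rnorm_ge0 _) hk.
rewrite le_eqVlt => /orP[/eqP k0|k0].
  have h0 : h = 0.
    apply/eqP; rewrite -rnorm_eq0 eq_le rnorm_ge0 andbT.
    by move: hk; rewrite -k0 sc0 sub0r rnormN.
  exists 0; split; first by rewrite -sc0; exact: pos_sc.
    by rewrite mulr0 h0.
  by move=> c _; rewrite mulr0 mul0r.
pose w := 1 - k^-1%:C *: h.
have kK : k^-1%:C * k%:C = 1 by rewrite -rmorphM mulVf ?gt_eqF.
have wE : w = k^-1%:C *: (sc k - h) by rewrite scalerBr /sc scalerA kK scale1r.
have w1 : rnorm w <= 1.
  by rewrite wE rnormZr ger0_norm ?invr_ge0 ?(ltW k0)// ler_pdivrMl// mulr1.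
have sw : star w = w by rewrite starB star1 starZr sh.
exists ((Num.sqrt k)%:C *: sqrt1m w); split.
- apply: posZ; first exact: sqrtr_ge0.
  split; first exact: star_sqrt1m.
  by exists 1; rewrite sc1 /sqrt1m subKr rnorm_visser_lim.
- rewrite -scalerAl -scalerAr scalerA -rmorphM -expr2 sqr_sqrtr ?(ltW k0)//.
  by rewrite sqrt1m_sqr// subKr scalerA mulrC kK scale1r.
- move=> c ch; rewrite -scalerAr -scalerAl; congr (_ *: _).
  apply: sqrt1m_intertwine => //.
  by rewrite mulrBr mulrBl mulr1 mul1r -scalerAr -scalerAl ch.
Qed.

Lemma pos_mul h x : pos h -> pos x -> h * x = x * h -> pos (h * x).
Proof.
move=> ph px hx.
have [u [[su _] uh uc]] := pos_sqrt ph; have [v [[sv _] vx vc]] := pos_sqrt px.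
have xu : x * u = u * x by apply: uc.
have uv : u * v = v * u by apply: vc.
have -> : h * x = (u * v) * (u * v).
  by rewrite -uh -vx [in RHS]mulrA -[u * v * u]mulrA -uv !mulrA.
by apply: pos_sqr; rewrite starM su sv.
Qed.

(** The roots [u] of [h] and [v] of [k - h] commute and [u^2 + v^2 = k], so [rnorm_sqrD_ge] passes
    from the order to the norm. *)
Lemma pos_rnorm_le h k : 0 <= k -> pos h -> pos (sc k - h) -> rnorm h <= k.
Proof.
move=> k0 ph pk.
have [u [[su _] uh uc]] := pos_sqrt ph; have [v [[sv _] vk vc]] := pos_sqrt pk.
have uv : u * v = v * u.
  apply: vc; rewrite mulrBr mulrBl sc_comm; congr (_ - _).
  by rewrite -uh mulrA.
by have := rnorm_sqrD_ge su sv uv; rewrite uh vk subrKC rnorm_sc ger0_norm.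
Qed.

(** The product [(k - x) (k + x) = k^2 - x^2] of commuting positive elements is positive, so the
    square of the norm of [x] is at most [k^2]. *)
Lemma pos_rnorm_sandwich x k : 0 <= k -> pos (sc k - x) -> pos (sc k + x) ->
  rnorm x <= k.
Proof.
move=> k0 p1 p2.
have sx : star x = x.
  by case: p2 => + _; rewrite starD star_sc => /addrI.
have C : sc k * x = x * sc k := sc_comm k x.
have E : (sc k - x) * (sc k + x) = sc (k * k) - x * x.
  by rewrite mulrBl !mulrDr -scM C opprD addrA addrK.
have E' : (sc k + x) * (sc k - x) = sc (k * k) - x * x.
  by rewrite mulrDl !mulrBr -scM C addrA subrK.
have : rnorm (x * x) <= k * k.
  apply: pos_rnorm_le; [by rewrite mulr_ge0|exact: pos_sqr|].
  by rewrite -E; apply: pos_mul; rewrite // E.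
by rewrite rnorm_sqr_sa// -expr2 ler_pXn2r ?nnegrE ?rnorm_ge0.
Qed.

(** With [k - h] of norm at most [k], factor [t + h = (t + k) (1 - (k - h) / (t + k))] and use the
    Neumann series. *)
Lemma pos_sc_unit t h : 0 < t -> pos h -> sc t + h \is a GRing.unit.
Proof.
move=> t0 [_ [k hk]]; have k0 : 0 <= k := le_trans (rnorm_ge0 _) hk.
have tk : 0 < t + k by lra.
have -> : sc t + h = sc (t + k) * (1 - (t + k)^-1%:C *: (sc k - h)).
  rewrite mulrBr mulr1 -scalerAr sc_mul scalerA -rmorphM mulVf ?gt_eqF//.
  by rewrite rmorph1 scale1r opprB scD addrACA subrr addr0.
rewrite unitrMr; last by apply: sc_unit; rewrite gt_eqF.
apply: (neumann _).1; rewrite rnormZr ger0_norm ?invr_ge0 ?(ltW tk)//.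
by rewrite ltr_pdivrMl// mulr1; lra.
Qed.

End Sqrt.

(** * Spectrum and functional calculus *)

Section Spectrum.
Local Open Scope complex_scope.
Context {R : realType} {A : unitalCstarAlg R}.
Implicit Types (a b h u x y z w : A) (t k e : R) (p q : {poly R}).

Lemma comm_unitl x y : x * y = y * x -> x * y \is a GRing.unit -> x \is a GRing.unit.
Proof. by move=> xy; rewrite (unitrM_comm xy) => /andP[]. Qed.

Lemma sub_mulD x y : x * y = y * x -> (x - y) * (x + y) = x * x - y * y.
Proof. by move=> C; rewrite mulrBl !mulrDr C opprD addrA addrK. Qed.

(** For [c = s + i t] with [t] nonzero, put [x = a - s] and [j = i t]: then
    [- (j - x) (j + x) = t^2 + x^2] is a positive scalar plus a square, hence invertible, and so is
    its commuting factor [j - x = c - a]. *)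
Lemma spectrum_sa_real a c : star a = a -> spectrum a c -> c = (complex.Re c)%:C.
Proof.
move=> sa; apply: contraPP => cr; apply/negP; rewrite negbK.
set s := complex.Re c in cr; set t := complex.Im c.
have cE : c = s%:C + 'i%C * t%:C by rewrite -complexE.
have t0 : t != 0.
  by apply/eqP => t0; apply: cr; rewrite {1}cE t0 rmorph0 mulr0 addr0.
pose x := a - sc s; pose j : A := ('i%C * t%:C)%:A.
have sx : star x = x by rewrite starB sa star_sc.
have jx : j * x = x * j by rewrite mulr_algl mulr_algr.
have jj : j * j = - sc (t ^+ 2).
  rewrite /j mulr_algl scalerA mulrACA -expr2 sqr_i -rmorphM -expr2 mulN1r.
  by rewrite scaleNr.
have -> : c%:A - a = j - x.
  by rewrite cE scalerDl /x opprB addrA [j + _]addrC.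
clearbody x j; have E : - ((j - x) * (j + x)) = sc (t ^+ 2) + x * x.
  by rewrite sub_mulD// jj opprB opprK addrC.
have C : (j - x) * (j + x) = (j + x) * (j - x).
  by rewrite sub_mulD// mulrDl !mulrBr jx addrA subrK.
apply: (comm_unitl C); rewrite -unitrN E; apply: pos_sc_unit; last exact: pos_sqr.
by rewrite lt_def sqrf_eq0 t0 sqr_ge0.
Qed.

Lemma spectrum_rnorm a t : spectrum a t%:C -> `|t| <= rnorm a.
Proof.
apply: contraPT; rewrite -ltNge => h; apply/negP; rewrite negbK.
have t0 : t != 0.
  by apply/eqP => t0; move: h; rewrite t0 normr0 ltNge rnorm_ge0.
have -> : t%:C%:A - a = sc t * (1 - t^-1%:C *: a).
  by rewrite mulrBr mulr1 sc_mul scalerA -rmorphM mulfV// rmorph1 scale1r.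
rewrite unitrMr; last exact: sc_unit.
by apply: (neumann _).1; rewrite rnormZr normfV ltr_pdivrMl ?normr_gt0// mulr1.
Qed.

Lemma pos_spectrum h t : pos h -> spectrum h t%:C -> 0 <= t.
Proof.
move=> ph; apply: contraPT; rewrite -ltNge => t0; apply/negP; rewrite negbK.
by rewrite -unitrN opprB addrC -scaleNr -rmorphN pos_sc_unit// oppr_gt0.
Qed.

(* If both [r - a] and [r + a] were invertible, then so would be [b = r^2 - a^2];
   [b^-1 <= m] gives [1 <= m b], so that [a^2 <= r^2 - 1 / m], contradicting
   [|a^2| = r^2]. *)
Lemma spectrum_attained a : star a = a ->
  exists2 t, spectrum a t%:C & `|t| = rnorm a.
Proof.
move=> sa; set r := rnorm a; have r0 : 0 <= r := rnorm_ge0 a.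
have [h1|/negP h1] := pselect (spectrum a r%:C).
  by exists r => //; rewrite ger0_norm.
have [h2|/negP h2] := pselect (spectrum a (- r)%:C).
  by exists (- r) => //; rewrite normrN ger0_norm.
exfalso; move: h1 h2; rewrite !negbK -/(sc r) -/(sc (- r)) => u1 u2.
have {}u2 : sc r + a \is a GRing.unit by rewrite -unitrN opprD -scN.
pose b := (sc r - a) * (sc r + a).
have bE : b = sc (r ^+ 2) - a * a by rewrite /b sub_mulD ?sc_comm// -scM expr2.
have ub : b \is a GRing.unit by rewrite unitrMl.
have naa : rnorm (a * a) = r ^+ 2 by rewrite rnorm_sqr_sa.
have sb : star b = b by rewrite bE starB star_sc starM sa.
have pb : pos b by rewrite bE; apply: pos_scB; rewrite ?naa// starM sa.
have sV : star b^-1 = b^-1 by rewrite starV// sb.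
have pc : pos b^-1.
  have -> : b^-1 = (b^-1 * b^-1) * b by rewrite mulrVK.
  by apply: pos_mul; [exact: pos_sqr|exact: pb|rewrite mulrVK// mulrA mulrV// mul1r].
set m := rnorm b^-1.
have m0 : 0 < m by rewrite lt_def rnorm_ge0 rnorm_eq0 andbT invr_eq0;
  apply/eqP => b0; move: ub; rewrite b0 unitr0.
have nb : rnorm b <= r ^+ 2.
  apply: pos_rnorm_le => //; first exact: sqr_ge0.
  by rewrite bE subKr; exact: pos_sqr.
have bm : 1 <= r ^+ 2 * m.
  rewrite -(@rnorm1 R A) -(mulrV ub) (le_trans (rnormM _ _))//.
  by rewrite ler_wpM2r// rnorm_ge0.
have pm : pos (sc m - b^-1) by apply: pos_scB.
have pmb : pos ((sc m - b^-1) * b).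
  by apply: pos_mul => //; rewrite mulrBl mulrBr mulVr// mulrV// sc_comm.
have k0 : 0 <= r ^+ 2 - m^-1.
  by rewrite subr_ge0 -[m^-1]mul1r ler_pdivrMr.
have : rnorm (a * a) <= r ^+ 2 - m^-1.
  apply: pos_rnorm_le => //; first exact: pos_sqr.
  have -> : sc (r ^+ 2 - m^-1) - a * a = m^-1%:C *: ((sc m - b^-1) * b).
    rewrite mulrBl mulVr// sc_mul scalerBr scalerA -rmorphM mulVf ?gt_eqF//.
    by rewrite rmorph1 scale1r bE scB addrAC.
  by apply: posZ => //; rewrite invr_ge0 ltW.
by rewrite naa; have := m0; rewrite -invr_gt0; lra.
Qed.

Lemma spectrum_shift a t k : spectrum (sc k - a) t%:C -> spectrum a (k - t)%:C.
Proof.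
rewrite /spectrum/= -/(sc t) -/(sc (k - t)) -unitrN scB.
by rewrite opprB addrAC.
Qed.

(** The norm of [rnorm h - h] is attained at a spectral point [t]; then [rnorm h - t] is in the
    spectrum of [h], thus between 0 and [rnorm h], and so is [t]. *)
Lemma spectrum_pos h : star h = h -> (forall t, spectrum h t%:C -> 0 <= t) -> pos h.
Proof.
move=> sh h0; have sk : star (sc (rnorm h) - h) = sc (rnorm h) - h.
  by rewrite starB star_sc sh.
apply: (pos_bound (rnorm_ge0 h) sh).
have [t /spectrum_shift th <-] := spectrum_attained sk.
have := spectrum_rnorm th; have := h0 _ th.
have := rnorm_ge0 h.
by rewrite !ler_norml; lra.
Qed.

(** The inverse of [t - y x] is [t^-1 (1 + y c x)] with [c] the inverse of [t - x y]. *)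
Lemma sub_mul_unit_swap t x y : t != 0 ->
  sc t - x * y \is a GRing.unit -> sc t - y * x \is a GRing.unit.
Proof.
move=> t0 u; set c := (sc t - x * y)^-1.
have K1 : (sc t - y * x) * y = y * (sc t - x * y).
  by rewrite mulrBl mulrBr sc_comm mulrA.
have K2 : x * (sc t - y * x) = (sc t - x * y) * x.
  by rewrite mulrBl mulrBr sc_comm mulrA.
have E1 : (sc t - y * x) * (1 + y * c * x) = sc t.
  by rewrite mulrDr mulr1 !mulrA K1 mulrK// subrK.
have E2 : (1 + y * c * x) * (sc t - y * x) = sc t.
  by rewrite mulrDl mul1r -[y * c * x * _]mulrA K2 mulrA mulrVK// subrK.
have ut := @sc_unit R A _ t0.
apply: (@unit_mul2 _ _ _ ((1 + y * c * x) * (sc t)^-1)).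
  by rewrite mulrA E1 mulrV.
have C : (1 + y * c * x) * (sc t)^-1 = (sc t)^-1 * (1 + y * c * x).
  apply: (mulrI ut); rewrite mulVKr// mulrA (sc_comm t (_ + _)).
  by rewrite mulrK.
by rewrite C -(mulrA (sc t)^-1) E2 mulVr.
Qed.

(** Both elements squared on the left are self-adjoint, so [w * star w + star w * w] is positive for
    every [w]. *)
Lemma sum_sqr_unfold w :
  (w + star w) * (w + star w) + ('i%C *: (w - star w)) * ('i%C *: (w - star w)) =
  (2%:R : R)%:C *: (w * star w + star w * w).
Proof.
have i2 : 'i%C * 'i%C = -1 :> R[i] by rewrite -expr2 sqr_i.
have -> : (w + star w) * (w + star w) =
    (w * w + star w * star w) + (w * star w + star w * w).
  by rewrite mulrDl !mulrDr [star w * w + _]addrC addrACA.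
have E : (w - star w) * (w - star w) =
    (w * w + star w * star w) - (w * star w + star w * w).
  by rewrite mulrBl !mulrBr opprB addrACA -opprD.
rewrite -scalerAl -scalerAr scalerA i2 scaleN1r E opprB.
rewrite addrC addrA subrK rmorph_nat scaler_nat mulr2n//.
Qed.

Lemma pos_eq0 h : pos h -> pos (- h) -> h = 0.
Proof.
move=> p1 p2; apply/eqP; rewrite -rnorm_eq0 eq_le rnorm_ge0 andbT.
by apply: pos_rnorm_le => //; rewrite sc0 sub0r.
Qed.

(* Kaplansky's argument: with a = z^* z, s = sqrt(a^2) and m = s - a >= 0, the
   element w = z m satisfies w^* w = - m^3 / 2 <= 0, hence w w^* <= 0 as well,
   whereas w^* w + w w^* >= 0; so m^3 = 0. *)
Lemma pos_star_mul z : pos (star z * z).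
Proof.
set a := star z * z; have sa : star a = a by rewrite starM starK.
have [s [ps ss scom]] := pos_sqrt (pos_sqr sa).
have as_ : a * s = s * a by apply: scom; rewrite mulrA.
have ssa : star s = s := ps.1.
have [m mE] : exists m, m = s - a by exists (s - a).
have [n nE] : exists n, n = s + a by exists (s + a).
have sm : star m = m by rewrite mE starB ssa sa.
have mn : m * n = 0 by rewrite mE nE sub_mulD// ss subrr.
have nm : n * m = 0 by rewrite nE mE mulrDl !mulrBr ss as_ addrA subrK subrr.
have pm : pos m.
  apply: spectrum_pos => // t; apply: contraPT; rewrite -ltNge => t0.
  apply/negP; rewrite negbK -/(sc t).
  have mnt : m + n = s + s by rewrite mE nE addrACA addNr addr0.
  (* From [m n = 0] and [m + n = 2 s] the product is [(- t) (- t + 2 s)], invertible for [t < 0]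
     since [s] is positive; so [t] is outside the spectrum of [m]. *)
  have E : (sc t - m) * (sc t - n) = (- t)%:C *: (sc (- t) + (s + s)).
    rewrite mulrBl !mulrBr mn subr0 -scM -sc_comm -addrA -opprD -mulrDr [n + m]addrC mnt.
    by rewrite scalerDr -!sc_mul -scM mulrNN [in RHS]scN mulNr.
  have E' : (sc t - n) * (sc t - m) = (- t)%:C *: (sc (- t) + (s + s)).
    rewrite mulrBl !mulrBr nm subr0 -scM -sc_comm -addrA -opprD -mulrDr mnt.
    by rewrite scalerDr -!sc_mul -scM mulrNN [in RHS]scN mulNr.
  apply: (@comm_unitl _ (sc t - n)); first by rewrite E E'.
  rewrite E -sc_mul unitrMl; last by apply: pos_sc_unit; rewrite ?oppr_gt0//; exact: posD.
  by apply: sc_unit; rewrite oppr_eq0 lt_eqF.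
pose w := z * m.
have wwE : star w * w = - ((2^-1)%:C *: (m * (m * m))).
  have h : m * m = - (a * m + a * m).
    have mE' : m = n - (a + a) by rewrite mE nE opprD addrA addrK.
    by rewrite {1}mE' mulrBl nm sub0r mulrDl.
  rewrite /w starM sm -mulrA [star z * _]mulrA -/a h mulrN scalerN opprK.
  by rewrite mulrDr half_addE.
have pww : pos (- (star w * w)).
  rewrite wwE opprK; apply: posZ; first by rewrite invr_ge0.
  by apply: pos_mul; [|exact: pos_sqr|rewrite mulrA].
(* Away from 0, [w * star w] and [star w * w] have the same spectrum. *)
have pw' : pos (- (w * star w)).
  apply: spectrum_pos; first by rewrite starN starM starK.
  move=> t; apply: contraPT; rewrite -ltNge => t0.
  apply/negP; rewrite negbK -/(sc t) opprK.
  have -> : sc t + w * star w = - (sc (- t) - w * star w) by rewrite scN opprB opprK addrC.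
  rewrite unitrN; apply: sub_mul_unit_swap; first by rewrite oppr_eq0 lt_eqF.
  by apply: pos_sc_unit; rewrite ?oppr_gt0.
have psum : pos (w * star w + star w * w).
  have : pos ((2%:R : R)%:C *: (w * star w + star w * w)).
    rewrite -sum_sqr_unfold; apply: posD; apply: pos_sqr.
      by rewrite starD starK addrC.
    rewrite starZ starB starK -(opprB w (star w)) scalerN -scaleNr.
    congr (_ *: _); apply/eqP.
    by rewrite eq_complex /= oppr0 opprK !eqxx.
  have h2 : 0 <= 2^-1 :> R by rewrite invr_ge0.
  by move=> /(posZ h2); rewrite scalerA -rmorphM mulVf ?rmorph1 ?scale1r.
have ww0 : star w * w = 0.
  by apply: pos_eq0 => //; rewrite -[X in pos X](addKr (w * star w)); exact: posD.
have mmm : m * (m * m) = 0.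
  apply/eqP; move/eqP: wwE; rewrite ww0 eq_sym oppr_eq0 scaler_eq0.
  by rewrite fmorph_eq0 invr_eq0 (@pnatr_eq0 R 2).
have m0 : m = 0.
  apply/eqP; rewrite -rnorm_eq0 -sqrf_eq0 -sqrf_eq0.
  rewrite -rnorm_sqr_sa// -rnorm_sqr_sa ?starM ?sm//.
  by rewrite -mulrA mmm mulr0 rnorm0.
by have -> : a = s by apply/esym/eqP; rewrite -subr_eq0 -mE m0.
Qed.

End Spectrum.

(** * Continuous functional calculus *)

Section FunctionalCalculus.
Local Open Scope complex_scope.
Context {R : realType} {A : unitalCstarAlg R}.
Implicit Types (a b h u x y z w : A) (t k e : R) (p q : {poly R}).

Lemma spectrum_polyeval p a t : spectrum a t%:C -> spectrum (polyeval p a) (p.[t])%:C.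
Proof.
move=> at_; apply/negP => u; move/negP: at_; apply.
have /factor_theorem[q qE] : root (p - p.[t]%:P) t.
  by rewrite /root hornerD hornerN hornerC subrr.
have E : polyeval q a * (sc t - a) = sc p.[t] - polyeval p a.
  rewrite -[RHS]opprB -[sc p.[t]](polyevalC _ a) -polyevalB qE.
  by rewrite polyevalM polyevalB polyevalX polyevalC -mulrN opprB.
have C : (sc t - a) * polyeval q a = polyeval q a * (sc t - a).
  apply: polyeval_intertwine.
  by rewrite mulrBl mulrBr sc_comm.
by apply: (comm_unitl C); rewrite C E.
Qed.

Lemma horner_alg_prod_unit (rs : seq R[i]) a :
  (forall c, c \in rs -> a - c%:A \is a GRing.unit) ->
  horner_alg a (\prod_(c <- rs) ('X - c%:P)) \is a GRing.unit.
Proof.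
elim: rs => [|c rs IH] H; first by rewrite big_nil rmorph1 unitr1.
rewrite big_cons rmorphM rmorphB/= horner_algX horner_algC unitrMl.
  by apply: H; rewrite mem_head.
by apply: IH => d drs; apply: H; rewrite in_cons drs orbT.
Qed.

(** The norm of [p(a)] is attained at a real spectral point [c]. Splitting [p - c] into linear
    factors over [R[i]], one of its roots [l] must be in the spectrum of [a]; such a root is real,
    and [c = p(l)]. *)
Lemma rnorm_polyeval_le p a k : star a = a ->
  (forall t, spectrum a t%:C -> `|p.[t]| <= k) -> rnorm (polyeval p a) <= k.
Proof.
move=> sa pk.
have sp : star (polyeval p a) = polyeval p a by rewrite star_polyeval sa.
have [t0 at0 _] := spectrum_attained sa.
have [c pc <-] := spectrum_attained sp.
set P := map_poly (real_complex R) (p - c%:P).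
have PE : horner_alg a P = polyeval p a - sc c.
  by rewrite -[LHS]/(polyeval (p - c%:P) a) polyevalB polyevalC.
(* For a constant [p] there is no root to use; the bound then comes from [t0], that is, from the
   spectrum being nonempty. *)
have [P0|P0] := eqVneq P 0.
  have /eqP : p - c%:P == 0 by rewrite -(map_poly_eq0 (real_complex R)) -/P P0.
  by move/eqP; rewrite subr_eq0 => /eqP pE; have := pk _ at0; rewrite pE hornerC.
have [rs Prs] := closed_field_poly_normal P.
have [H|/existsNP[l /not_implyP[lrs lu]]] :=
  pselect (forall l, l \in rs -> a - l%:A \is a GRing.unit).
  exfalso; move/negP: pc; apply; rewrite -/(sc c) -unitrN opprB -PE Prs.
  rewrite -mul_polyC rmorphM/= horner_algC unitrMl ?horner_alg_prod_unit//.
  have l0 : lead_coef P != 0 by rewrite lead_coef_eq0.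
  apply: (@unit_mul2 _ _ _ (lead_coef P)^-1%:A);
    by rewrite mulr_algl scalerA (mulfV, mulVf)// scale1r.
have al : spectrum a l by apply/negP; rewrite -unitrN opprB.
have lr := spectrum_sa_real sa al.
have : root P l by rewrite Prs rootZ ?lead_coef_eq0// root_prod_XsubC.
rewrite lr /P /root horner_map/= fmorph_eq0 hornerD hornerN hornerC subr_eq0 => /eqP <-.
by apply: pk; rewrite -lr.
Qed.

(** Two sequences of polynomials close to [f] on the spectrum are close to each other there, so
    [rnorm_polyeval_le] forces equal limits. Any convenient sequence therefore computes the element
    chosen by [cfc]. *)
Lemma cfcE (f : R -> R) a (p : nat -> {poly R}) b : star a = a ->
  (forall e : R, 0 < e -> \forall n \near \oo,
       forall t : R, spectrum a t%:C -> `|(p n).[t] - f t| <= e) ->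
  polyeval (p n) a @[n --> \oo] --> b -> cfc f a = b.
Proof.
move=> sa pf pb; apply: xget_unique; first by exists p.
move=> y [q [qf qy]]; apply/eqP; rewrite -subr_eq0 -rnorm_eq0 eq_le rnorm_ge0 andbT.
have D : polyeval (q n) a - polyeval (p n) a @[n --> \oo] --> y - b by exact: cvgB.
apply/ler_addgt0Pl => e e0; rewrite addr0.
apply: (cvgr_to_le (cvg_rnorm D)).
have e2 : 0 < e / 2 by lra.
have H1 := pf _ e2; have H2 := qf _ e2.
near=> n; rewrite -polyevalB; apply: rnorm_polyeval_le => // t at_.
have h1 : forall t, spectrum a t%:C -> `|(p n).[t] - f t| <= e / 2 by near: n.
have h2 : forall t, spectrum a t%:C -> `|(q n).[t] - f t| <= e / 2 by near: n.
move: (h1 t at_) (h2 t at_); rewrite hornerD hornerN !ler_norml; lra.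
Unshelve. all: by end_near. Qed.

Section Approx.
Context (f : R -> R) (a : A) (p : nat -> {poly R}) (d : nat -> R).
Context (sa : star a = a) (d0 : d n @[n --> \oo] --> 0).
Context (pd : forall n t, spectrum a t%:C -> `|(p n).[t] - f t| <= d n).

Lemma approx_unif e : 0 < e -> \forall n \near \oo,
  forall t : R, spectrum a t%:C -> `|(p n).[t] - f t| <= e.
Proof.
move=> e0; move/cvgrPdist_lt/(_ _ e0): d0; apply: filterS => n.
rewrite sub0r normrN => /ltr_normlW dn t at_.
by rewrite (le_trans (pd n at_))// ltW.
Qed.

Lemma cvg_cfc : polyeval (p n) a @[n --> \oo] --> cfc f a.
Proof.
suff [b pb] : exists b, polyeval (p n) a @[n --> \oo] --> b.
  by rewrite (cfcE sa approx_unif pb).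
have /cvg_ex[b bE] : cvg (polyeval (p n) a @[n --> \oo]).
  apply/cauchy_cvgP/cauchy_ballP => e e0.
  have er : e = (complex.Re e)%:C by rewrite RRe_real// gtr0_real.
  have e3 : 0 < complex.Re e / 3 by rewrite divr_gt0// -ltcR -er.
  have [N _ HN] := approx_unif e3.
  rewrite near_map2; near=> n m.
  have Nn : (N <= n)%N by near: n; exists N.
  have Nm : (N <= m)%N by near: m; exists N.
  rewrite -ball_normE/= normE er ltcR -polyevalB.
  apply: (@le_lt_trans _ _ (2 * (complex.Re e / 3))); last by lra.
  apply: rnorm_polyeval_le => // t at_.
  have := HN n Nn t at_; have := HN m Nm t at_.
  by rewrite hornerD hornerN !ler_norml; lra.
by exists b.
Unshelve. all: by end_near. Qed.

Lemma cfc_comm (c : A) : c * a = a * c -> c * cfc f a = cfc f a * c.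
Proof.
move=> ca; apply: (cvg_uniq (cvg_mul (cvg_cst c) cvg_cfc)).
under eq_fun do rewrite (polyeval_intertwine _ ca).
exact: cvg_mul cvg_cfc (cvg_cst c).
Qed.

Lemma rnorm_cfc_le k : (forall t, spectrum a t%:C -> `|f t| <= k) ->
  rnorm (cfc f a) <= k.
Proof.
move=> fk; apply/ler_addgt0Pl => e e0.
apply: (cvgr_to_le (cvg_rnorm cvg_cfc)).
have H := approx_unif e0; near=> n.
apply: rnorm_polyeval_le => // t at_.
have h : forall t, spectrum a t%:C -> `|(p n).[t] - f t| <= e by near: n.
by move: (h t at_) (fk t at_); rewrite !ler_norml; lra.
Unshelve. all: by end_near. Qed.

(** Spectral mapping is only needed for the polynomials [p n]: the value at [t] is a spectral point
    of [p n] at [a], and the inequality passes to the limit. *)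
Lemma rnorm_cfc_ge t : spectrum a t%:C -> `|f t| <= rnorm (cfc f a).
Proof.
move=> at_; apply/ler_addgt0Pl => e e0; rewrite addrC -lerBlDr.
apply: (cvgr_to_ge (cvg_rnorm cvg_cfc)).
have H := approx_unif e0; near=> n.
have h : forall t, spectrum a t%:C -> `|(p n).[t] - f t| <= e by near: n.
have := spectrum_rnorm (spectrum_polyeval (p n) at_).
have := h t at_; have := ler_distD (p n).[t] (f t) 0.
by rewrite !subr0 distrC; lra.
Unshelve. all: by end_near. Qed.

End Approx.

End FunctionalCalculus.

(** * The logarithm of the cross ratio *)

Section LnApprox.
Context {R : realType}.
Implicit Types (x q k : R) (p : {poly R}).

(** Taylor polynomial of [- ln (1 - x)]; its constant term is [0^-1], which is 0. *)
Definition lnpoly n : {poly R} := \poly_(i < n.+1) (i%:R^-1).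

Lemma deriv_lnpoly n : (lnpoly n)^`() = \sum_(i < n) 'X^i.
Proof.
apply/polyP => i; rewrite coef_deriv coef_poly ltnS.
rewrite coef_sum; under eq_bigr do rewrite coefXn eq_sym.
have [ni|ni] := ltnP i n.
  rewrite (bigD1 (Ordinal ni))//= eqxx big1 ?addr0.
    by rewrite -[LHS]mulr_natr mulVf// pnatr_eq0.
  by move=> j; rewrite -val_eqE/= => /negbTE ->.
rewrite mul0rn big1// => j _; rewrite ltn_eqF//.
by rewrite (leq_trans (ltn_ord j)).
Qed.

(** By the geometric sum the remainder has derivative [- y^n / (1 - y)], and it vanishes at 0; the
    mean value theorem gives the bound. *)
Lemma ln_approx x q n : 0 <= x <= q -> q < 1 ->
  `|ln (1 - x) + (lnpoly n).[x]| <= q ^+ n / (1 - q).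
Proof.
move=> /andP[x0 xq] q1.
pose g (y : R) := ln (1 - y) + (lnpoly n).[y].
pose dg (y : R) := - (y ^+ n / (1 - y)).
have gd (y : R) : y < 1 -> is_derive y 1 g (dg y).
  move=> y1; have y1' : 0 < 1 - y by rewrite subr_gt0.
  have h1 : is_derive (1 - y) 1 (@ln R) (1 - y)^-1 by exact: is_derive1_ln.
  have h2 : is_derive y 1 (fun y => 1 - y) (-1 : R).
    by rewrite -[-1]add0r; exact: (is_deriveB (is_derive_cst (1 : R) y 1) (is_derive_id y 1)).
  have h3 := @is_derive1_comp _ (@ln R) (fun y => 1 - y) y _ _ h1 h2.
  have h4 := is_derive_poly (lnpoly n) y.
  apply: is_derive_eq.
  rewrite deriv_lnpoly horner_sum.
  under eq_bigr do rewrite hornerXn.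
  have := subrX1 y n; set S := \sum_(i < n) _ => hS.
  have -> : S = (1 - y ^+ n) / (1 - y).
    by apply: (mulIf (lt0r_neq0 y1')); rewrite divfK ?lt0r_neq0//; lra.
  by rewrite /dg; field; rewrite lt0r_neq0.
have [c c0x] : exists2 c, c \in `[0, x]%R & g x - g 0 = dg c * (x - 0).
  apply: MVT_segment => //.
    by move=> y; rewrite in_itv/= => /andP[_ yx]; apply: gd; lra.
  apply: derivable_within_continuous => y.
  rewrite in_itv/= => /andP[_ yx].
  by have [] : is_derive y 1 g (dg y) by apply: gd; lra.
rewrite /g subr0 ln1 add0r subr0.
have -> : (lnpoly n).[0] = 0 by rewrite horner_coef0 coef_poly/= invr0.
rewrite subr0 => ->.
move: c0x; rewrite in_itv/= => /andP[c0 cx].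
rewrite /dg normrM normrN normrM (ger0_norm x0) normfV.
rewrite (ger0_norm (exprn_ge0 _ c0)) ger0_norm; last lra.
have qn : c ^+ n <= q ^+ n by rewrite lerXn2r ?nnegrE//; lra.
have i1 : (1 - c)^-1 <= (1 - q)^-1 by rewrite lef_pV2 ?posrE; lra.
have i0 : 0 <= (1 - c)^-1 by rewrite invr_ge0; lra.
have cn := exprn_ge0 n c0.
rewrite -[leRHS]mulr1; apply: ler_pM => //; [exact: mulr_ge0| |lra].
exact: ler_pM.
Qed.

End LnApprox.

(** * Absolute value, cross ratio and operator norm *)

Section OperatorNorm.
Local Open Scope complex_scope.
Context {R : realType} {A : unitalCstarAlg R}.
Implicit Types (a b h u x y z w : A) (t k e : R).

Lemma pos_rnorm_scB h k : pos h -> rnorm h <= k -> rnorm (sc k - h) <= k.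
Proof.
move=> ph hk; apply: pos_rnorm_le; first exact: le_trans (rnorm_ge0 h) hk.
  by apply: pos_scB => //; case: ph.
by rewrite subKr.
Qed.

Lemma star_mul_bound z : rnorm z <= 1 -> rnorm (1 - star z * z) <= 1.
Proof.
move=> z1; rewrite -sc1; apply: pos_rnorm_scB; first exact: pos_star_mul.
by rewrite rnormE expr_le1 ?rnorm_ge0.
Qed.

(** Since [sqrt t = sqrt (1 - (1 - t))], composing the iteration with [1 - X] approximates the
    square root uniformly on [0, 1], which contains the spectrum of [star z * z]. *)
Lemma cabsE z : rnorm z <= 1 -> cabs z = sqrt1m (1 - star z * z).
Proof.
move=> z1; set a := star z * z; have sa : star a = a by rewrite starM starK.
pose p n : {poly R} := (1 - visser n) \Po (1 - 'X).
apply: (cfcE (p := p) sa); last first.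
  have [vc _] := visser_cvg (star_mul_bound z1).
  rewrite /p; under eq_fun do
    rewrite polyeval_comp polyevalB (polyevalB 1 'X) !polyeval1 polyevalX.
  by apply: cvgB; [exact: cvg_cst|exact: vc].
move=> e e0; apply: (approx_unif (a := a) cvg_2harmonic) e0 => n t at_.
have t0 : 0 <= t by apply: pos_spectrum at_; exact: pos_star_mul.
have t1 : t <= 1.
  have := spectrum_rnorm at_; rewrite rnormE ger0_norm// => /le_trans; apply.
  by rewrite expr_le1 ?rnorm_ge0.
have ht : 0 <= 1 - t <= 1 by lra.
rewrite /p horner_comp !hornerE.
have [_ h1 h2] := visser_bound n ht; rewrite subKr in h1 h2.
rewrite ler_norml; apply/andP; split.
  by apply: (@le_trans _ _ 0); [rewrite oppr_le0 divr_ge0|lra].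
by apply: le_trans h2; lra.
Qed.

Section Ball.
Context (z : A) (hz : ball1 z).
Let r := rnorm z.
Let a := star z * z.
Let s := cabs z.

Let r1 : r < 1. Proof. exact: hz. Qed.
Let r0 : 0 <= r. Proof. exact: rnorm_ge0. Qed.
Let az1 : rnorm (1 - a) <= 1. Proof. exact/star_mul_bound/ltW/hz. Qed.
Let sE : s = sqrt1m (1 - a). Proof. exact/cabsE/ltW/hz. Qed.

Lemma pos_cabs : pos (cabs z).
Proof.
rewrite -/s sE; split.
  by apply: star_sqrt1m => //; rewrite starB star1 starM starK.
by exists 1; rewrite sc1 /sqrt1m subKr rnorm_visser_lim.
Qed.

Lemma cabs_sqr : cabs z * cabs z = star z * z.
Proof. by rewrite -/s sE sqrt1m_sqr// subKr. Qed.

Lemma cabs_comm x : x * a = a * x -> x * cabs z = cabs z * x.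
Proof.
move=> xa; rewrite -/s sE; apply: sqrt1m_intertwine => //.
by rewrite mulrBl mulrBr xa mulr1 mul1r.
Qed.

Lemma rnorm_cabs : rnorm (cabs z) = r.
Proof.
have ps := pos_cabs; apply/eqP; rewrite -(@eqrXn2 _ 2)// ?rnorm_ge0//.
by rewrite -rnorm_sqr_sa ?cabs_sqr ?rnormE//; case: ps.
Qed.

Lemma spectrum_cabs : spectrum s r%:C.
Proof.
have [ss _] := pos_cabs; have [t st] := spectrum_attained ss.
by rewrite rnorm_cabs ger0_norm ?(pos_spectrum pos_cabs st)// => <-.
Qed.

Let us : 1 - s \is a GRing.unit.
Proof. by apply: (neumann _).1; rewrite rnorm_cabs. Qed.

Let C := (1 + s) * (1 - s)^-1.
Let K := (1 + r) / (1 - r).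

Let V_comm x : x * s = s * x -> x * (1 - s)^-1 = (1 - s)^-1 * x.
Proof.
move=> xs; apply: (mulIr us); rewrite mulrVK// -mulrA.
have -> : x * (1 - s) = (1 - s) * x by rewrite mulrBl mulrBr xs mulr1 mul1r.
by rewrite mulKr.
Qed.

Lemma cross_ratio_comm x : x * a = a * x -> x * C = C * x.
Proof.
move=> /cabs_comm; rewrite -/s => xs; rewrite /C mulrA -[RHS]mulrA -V_comm// mulrA.
by congr (_ * _); rewrite mulrDl mulrDr xs mulr1 mul1r.
Qed.

Lemma star_cross_ratio : star C = C.
Proof.
have ss : star s = s := pos_cabs.1.
rewrite /C starM starV// starB starD !star1 ss -V_comm//.
by rewrite mulrDl mulrDr mulr1 mul1r.
Qed.

(** This reads the spectrum of [C] off that of [s] as its image under [u |-> (1 + u) / (1 - u)], by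
    pure algebra. *)
Let spec_CE t : sc t - C = (sc (t - 1) - sc (t + 1) * s) * (1 - s)^-1.
Proof.
apply: (mulIr us); rewrite mulrVK// mulrBl /C mulrVK//.
rewrite mulrBr mulr1 scB scD sc1 mulrDl mul1r !opprD !addrA; congr (_ - _).
by rewrite addrAC.
Qed.

Lemma spectrum_cross_ratio t : spectrum C t%:C -> 1 <= t <= K.
Proof.
move=> /negP; rewrite -/(sc t) spec_CE unitrMl ?unitrV//.
(* At [t = -1] the first factor is the invertible scalar [-2]; otherwise it is [(t + 1) (u - s)]
   with [u] the preimage of [t]. *)
have [t1|t1] := eqVneq (t + 1) 0.
  rewrite t1 sc0 mul0r subr0 sc_unit//.
  by apply/eqP => h; move: t1 h; lra.
set u := (t - 1) / (t + 1).
have uE : u * (t + 1) = t - 1 by rewrite divfK.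
have -> : sc (t - 1) - sc (t + 1) * s = sc (t + 1) * (sc u - s).
  by rewrite mulrBr -scM mulrC uE.
rewrite unitrMr; last exact: sc_unit.
move/negP => us_; have u0 := pos_spectrum pos_cabs us_.
have := spectrum_rnorm us_; rewrite rnorm_cabs ger0_norm// => ur.
have r1' := r1; have u1 : 0 < 1 - u by lra.
have tE : t = (1 + u) / (1 - u).
  by apply: (mulIf (lt0r_neq0 u1)); rewrite divfK ?lt0r_neq0//; lra.
rewrite tE; apply/andP; split; first by rewrite ler_pdivlMr//; lra.
rewrite ler_pdivrMr// /K mulrAC ler_pdivlMr; nra.
Qed.

Lemma spectrum_cross_ratio_max : spectrum C K%:C.
Proof.
have r1' : 0 < 1 - r by rewrite subr_gt0 r1.
have k1 : K + 1 = 2 / (1 - r) by rewrite /K; field; rewrite lt0r_neq0.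
have k2 : K - 1 = (K + 1) * r by rewrite k1 /K; field; rewrite lt0r_neq0.
have k0 : K + 1 != 0 by rewrite k1 lt0r_neq0// divr_gt0.
apply/negP; rewrite -/(sc K) spec_CE unitrMl ?unitrV// k2 scM -mulrBr unitrMr.
  by have /negP := spectrum_cabs.
exact: sc_unit.
Qed.

Let K1 : 1 <= K.
Proof. by have /spectrum_cross_ratio/andP[] := spectrum_cross_ratio_max. Qed.

(** The spectrum of [C] lies in [1, K], so [x = 1 - t / K] stays in [0, q] with [q < 1]. There
    [ln t = ln K + ln (1 - x)], and [lnpoly] converges geometrically. *)
Let q := 1 - K^-1.
Let lnp n : {poly R} := (ln K)%:P - (lnpoly n \Po (1 - K^-1 *: 'X)).

Let lnp_approx n t : spectrum C t%:C -> `|(lnp n).[t] - ln t| <= q ^+ n / (1 - q).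
Proof.
move=> /spectrum_cross_ratio/andP[t1 tK].
have K0 : 0 < K by have := K1; lra.
have iK : 0 < K^-1 by rewrite invr_gt0.
have KK : K^-1 * K = 1 by rewrite mulVf// lt0r_neq0.
pose x := 1 - K^-1 * t.
have xq : 0 <= x <= q by rewrite /x /q; nra.
have q1 : q < 1 by rewrite /q; lra.
have := ln_approx n xq q1.
have -> : ln (1 - x) = ln t - ln K.
  rewrite /x subKr lnM ?posrE//; last lra.
  by rewrite lnV ?posrE// addrC.
rewrite /lnp hornerD hornerN hornerC horner_comp !hornerE -/x.
by rewrite -normrN; congr (`|_| <= _); lra.
Qed.

Let q_cvg : q ^+ n / (1 - q) @[n --> \oo] --> 0.
Proof.
rewrite -[X in _ --> X](mul0r (1 - q)^-1); apply: cvgMl; apply: cvg_expr.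
have K0 : 0 < K by have := K1; lra.
have iK : 0 < K^-1 by rewrite invr_gt0.
have KK : K^-1 <= 1 by rewrite invf_le1.
by rewrite ger0_norm /q; lra.
Qed.

Let L := cfc (@ln R) C.

Lemma rnorm_log : rnorm L = ln K.
Proof.
apply/eqP; rewrite eq_le; apply/andP; split.
  apply: (rnorm_cfc_le star_cross_ratio q_cvg lnp_approx) => t.
  move=> /spectrum_cross_ratio/andP[t1 tK].
  by rewrite ger0_norm ?ln_ge0// ler_ln ?posrE//; lra.
have := rnorm_cfc_ge star_cross_ratio q_cvg lnp_approx spectrum_cross_ratio_max.
exact: le_trans (ler_norm _).
Qed.

Lemma log_comm x : x * a = a * x -> x * L = L * x.
Proof.
move=> /cross_ratio_comm.
exact: (cfc_comm star_cross_ratio q_cvg lnp_approx).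
Qed.

Lemma ell_genM x i : (ell_gen z *m x%:M) i ord0 = ell_gen z i ord0 * x.
Proof. by rewrite mxE big_ord1 !mxE eqxx mulr1n. Qed.

Lemma ell_gen0 : ell_gen z ord0 ord0 = 1. Proof. by rewrite mxE. Qed.
Lemma ell_gen1 : ell_gen z ord_max ord0 = z. Proof. by rewrite mxE. Qed.

Lemma log_endoE x :
  log_endo z (cr0 z) (ell_gen z *m x%:M) = ell_gen z *m (L * x)%:M.
Proof.
by rewrite /log_endo /cr0 /ell_endo !ell_genM ell_gen0 !mul1r mulr1.
Qed.

Lemma ell_opnorm_log : ell_opnorm z (log_endo z (cr0 z)) = (ln K)%:E.
Proof.
have [u [[su _] uu uc]] : exists u, [/\ pos u, u * u = 1 + a
    & forall x, x * (1 + a) = (1 + a) * x -> x * u = u * x].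
  by apply: pos_sqrt; rewrite -sc1; apply: posD; [exact: pos_sc|exact: pos_star_mul].
have nE x : colnorm (ell_gen z *m x%:M) = rnorm (u * x).
  rewrite /colnorm /dot !ell_genM ell_gen0 ell_gen1 mul1r starM.
  have -> : star x * x + star x * star z * (z * x) = star (u * x) * (u * x).
    rewrite starM su !mulrA -[star x * u * u]mulrA uu mulrDr mulr1 mulrDl.
    by rewrite /a !mulrA.
  by rewrite rnormE sqrtr_sqr ger0_norm ?rnorm_ge0.
have uL : L * u = u * L.
  apply: uc; rewrite mulrDl mulrDr mul1r mulr1; congr (_ + _); exact/esym/log_comm.
have uu_ : u \is a GRing.unit.
  have : u * u \is a GRing.unit.
    by rewrite uu -sc1; apply: pos_sc_unit => //; exact: pos_star_mul.
  exact: comm_unitl.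
apply/eqP; rewrite eq_le; apply/andP; split.
  apply: ge_ereal_sup => _ [_ [[x _ <-] /= x1] <-].
  rewrite log_endoE lee_fin nE mulrA -uL -mulrA -rnorm_log.
  move: x1; rewrite nE => x1; apply: le_trans (rnormM _ _) _.
  by rewrite -[leRHS]mulr1 ler_wpM2l// rnorm_ge0.
(* The vector with coordinate [u^-1] has norm 1, and its image has the norm of [u L u^-1 = L], so
   the supremum is attained. *)
apply: ereal_sup_ubound; exists (ell_gen z *m (u^-1)%:M).
  by split; [exists u^-1|rewrite /= nE mulrV// rnorm1].
by rewrite log_endoE nE mulrA -uL mulrK// rnorm_log.
Qed.

End Ball.
End OperatorNorm.

(** * The invariant Finsler metric *)

Section Moebius.
Local Open Scope complex_scope.
Context {R : realType} {A : unitalCstarAlg R}.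
Implicit Types (a b h u v w x y z : A) (t k e : R).

(** The defect operator of the contraction [z]. *)
Definition defect z : A := sqrt1m (star z * z).

Lemma star_mul_le1 z : ball1 z -> rnorm (star z * z) < 1.
Proof. by move=> z1; rewrite rnormE expr_lt1 ?rnorm_ge0. Qed.

Lemma ball1_star z : ball1 z -> ball1 (star z).
Proof. by rewrite /ball1/= rnorm_star. Qed.

Lemma defect_sqr z : ball1 z -> defect z * defect z = 1 - star z * z.
Proof. by move=> /star_mul_le1/ltW/sqrt1m_sqr. Qed.

Lemma star_defect z : ball1 z -> star (defect z) = defect z.
Proof.
by move=> /star_mul_le1/ltW z1; apply: star_sqrt1m; rewrite // starM starK.
Qed.

Lemma defect_unit z : ball1 z -> defect z \is a GRing.unit.
Proof.
move=> z1; apply: (@comm_unitl _ _ _ (defect z)) => //.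
by rewrite defect_sqr//; apply: (neumann _).1; exact: star_mul_le1.
Qed.

Lemma defect_intertwine z : ball1 z -> z * defect z = defect (star z) * z.
Proof.
move=> z1; apply: sqrt1m_intertwine; last by rewrite starK mulrA.
  exact/ltW/star_mul_le1.
exact/ltW/star_mul_le1/ball1_star.
Qed.

Lemma intertwine_inv x a b : a \is a GRing.unit -> b \is a GRing.unit ->
  x * a = b * x -> x * a^-1 = b^-1 * x.
Proof.
move=> ua ub xab; apply: (mulrI ub); rewrite mulVKr// mulrA -xab mulrK//.
Qed.

Lemma mulmx2E n (g : 'M[A]_2) (x : 'M[A]_(2, n)) i j :
  (g *m x) i j = g i ord0 * x ord0 j + g i ord_max * x ord_max j.
Proof.
rewrite mxE big_ord_recr big_ord1/=; congr (g i _ * x _ j + _); exact: val_inj.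
Qed.

Lemma ord2P (i : 'I_2) : i = ord0 \/ i = ord_max.
Proof.
by case: i => [[|[|//]] i2]; [left|right]; apply: val_inj.
Qed.

Definition mx2 x y z w : 'M[A]_2 :=
  \matrix_(i, j) if i == ord0 then (if j == ord0 then x else y)
                 else (if j == ord0 then z else w).

Lemma mx2E x y z w :
  [/\ mx2 x y z w ord0 ord0 = x, mx2 x y z w ord0 ord_max = y,
      mx2 x y z w ord_max ord0 = z & mx2 x y z w ord_max ord_max = w].
Proof. by rewrite !mxE. Qed.

Section Point.
Context (z : A) (hz : ball1 z).
Let E := defect z.
Let D := defect (star z).
Let uE : E \is a GRing.unit. Proof. exact: defect_unit. Qed.
Let uD : D \is a GRing.unit. Proof. exact/defect_unit/ball1_star. Qed.
Let EE : E * E = 1 - star z * z. Proof. exact: defect_sqr. Qed.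
Let DD : D * D = 1 - z * star z.
Proof. by rewrite /D defect_sqr ?starK//; exact: ball1_star. Qed.
Let zE : z * E = D * z. Proof. exact: defect_intertwine. Qed.
Let zD : star z * D = E * star z.
Proof. by rewrite /D defect_intertwine ?starK//; exact: ball1_star. Qed.
Let zVE : z * E^-1 = D^-1 * z. Proof. exact: intertwine_inv. Qed.
Let zVD : star z * D^-1 = E^-1 * star z. Proof. exact: intertwine_inv. Qed.

(* The hyperbolic translation of the ball moving [0] to [z]. *)
Definition transvec : 'M[A]_2 := mx2 E^-1 (E^-1 * star z) (D^-1 * z) D^-1.

Let P := E^-1 * E^-1.
Let Q := D^-1 * D^-1.
Let PE : (1 - star z * z) * P = 1.
Proof. by rewrite -EE /P mulrA mulrK// mulrV. Qed.
Let PE' : P * (1 - star z * z) = 1.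
Proof. by rewrite -EE /P mulrA mulrVK// mulVr. Qed.
Let QE : Q * (1 - z * star z) = 1.
Proof. by rewrite -DD /Q mulrA mulrVK// mulVr. Qed.
Let Qz : Q * z = z * P.
Proof. by rewrite /Q /P mulrA zVE -!mulrA zVE. Qed.

Lemma transvec_Utheta : Utheta transvec.
Proof.
have [g00 g01 g10 g11] := mx2E E^-1 (E^-1 * star z) (D^-1 * z) D^-1.
split; last first.
  move=> x y; rewrite /theta !mulmx2E g00 g01 g10 g11.
  have sE : star E^-1 = E^-1 by rewrite starV// star_defect.
  have sD : star D^-1 = D^-1 by rewrite starV// star_defect//; exact: ball1_star.
  set x0 := x ord0 ord0; set x1 := x ord_max ord0.
  set y0 := y ord0 ord0; set y1 := y ord_max ord0.
  pose v := y0 + star z * y1.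
  have -> : E^-1 * y0 + E^-1 * star z * y1 = E^-1 * v by rewrite -mulrA -mulrDr.
  have -> : E^-1 * x0 + E^-1 * star z * x1 = E^-1 * (x0 + star z * x1).
    by rewrite -mulrA -mulrDr.
  have -> : D^-1 * z * y0 + D^-1 * y1 = D^-1 * (z * y0 + y1) by rewrite -mulrA -mulrDr.
  have -> : D^-1 * z * x0 + D^-1 * x1 = D^-1 * (z * x0 + x1) by rewrite -mulrA -mulrDr.
  rewrite !starM sE sD -!mulrA [E^-1 * (_ * v)]mulrA -/P [D^-1 * (D^-1 * _)]mulrA -/Q.
  (* Everything is rewritten in [T = P v], for which [y0 + star z * y1 = T - star z * z * T]; the
     two forms then agree after cancellation. *)
  have -> : Q * (z * y0 + y1) = z * (P * v) + y1.
    have -> : z * y0 + y1 = z * v + (1 - z * star z) * y1.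
      by rewrite /v mulrDr mulrBl mul1r -addrA -mulrA subrKC.
    by rewrite mulrDr (mulrA Q z v) Qz -(mulrA z P v) (mulrA Q (1 - _)) QE mul1r.
  rewrite !starD !starM starK; set X0 := star x0; set X1 := star x1.
  set T := P * v.
  have vE : v = T - star z * z * T by rewrite -{1}[T]mul1r -mulrBl /T mulrA PE mul1r.
  have cancel (p q r s o : A) : p + q - (r + s + (q + o)) = p - r - s - o.
    by rewrite addrCA opprD addrA addrK !opprD !addrA.
  have -> : X0 * y0 = X0 * T - X0 * (star z * (z * T)) - X0 * (star z * y1).
    by rewrite -!(mulrBr X0); congr (X0 * _); rewrite mulrA -vE /v addrK.
  rewrite (mulrDl X0) (mulrDl (X0 * star z)) (mulrDr (X0 * star z)) (mulrDr X1).
  by rewrite -!(mulrA X0) -(mulrA X1) cancel.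
(* The inverse is the translation for [- z], which has the same [E] and [D]. *)
pose k : 'M[A]_2 := mx2 E^-1 (- (E^-1 * star z)) (- (D^-1 * z)) D^-1.
have [k00 k01 k10 k11] := mx2E E^-1 (- (E^-1 * star z)) (- (D^-1 * z)) D^-1.
have e1 : E^-1 * E^-1 - E^-1 * star z * (D^-1 * z) = 1.
  by rewrite mulrA -(mulrA _ _ D^-1) zVD !mulrA -/P -mulrA -{1}[P]mulr1 -mulrBr PE'.
have e2 : D^-1 * D^-1 - D^-1 * z * (E^-1 * star z) = 1.
  by rewrite mulrA -(mulrA _ _ E^-1) zVE !mulrA -/Q -mulrA -{1}[Q]mulr1 -mulrBr QE.
have e3 : E^-1 * star z * D^-1 = E^-1 * (E^-1 * star z) by rewrite -mulrA zVD.
have e4 : D^-1 * z * E^-1 = D^-1 * (D^-1 * z) by rewrite -mulrA zVE.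
exists k; split; apply/matrixP => i j; rewrite mulmx2E;
  case: (ord2P i) => ->; case: (ord2P j) => ->;
  rewrite /transvec ?g00 ?g01 ?g10 ?g11 /k ?k00 ?k01 ?k10 ?k11 !mxE/=
    ?mulrN ?mulNr ?e1 ?e3 ?e4 ?subrr ?addNr//.
  by rewrite addrC e2.
by rewrite addrC e2.
Qed.

Lemma moebius_transvec0 : moebius transvec 0 = z.
Proof.
rewrite /moebius; have [-> -> -> ->] := mx2E E^-1 (E^-1 * star z) (D^-1 * z) D^-1.
by rewrite !mulr0 !addr0 invrK -mulrA zE mulKr.
Qed.

Let den x := E^-1 + E^-1 * star z * x.

(** An exact increment formula: the difference quotients at 0 become [D w (den x)^-1], and the
    derivative only requires continuity of the inverse. *)
Lemma moebius_transvecB x : den x \is a GRing.unit ->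
  moebius transvec x - z = D * x * (den x)^-1.
Proof.
move=> ux; rewrite /moebius.
have [-> -> -> ->] := mx2E E^-1 (E^-1 * star z) (D^-1 * z) D^-1.
rewrite -/(den x) -[X in _ - X](mulrK ux) -mulrBl; congr (_ * _).
rewrite /den mulrDr !mulrA zVE [_ + D^-1 * x]addrC addrKA -mulrA -mulrA.
rewrite [z * (star z * x)]mulrA -mulrBr -{1}[x]mul1r -mulrBl -DD !mulrA mulVr//.
by rewrite mul1r.
Qed.

Lemma derive_moebius_transvec w : 'D_w (moebius transvec) 0 = D * w * E.
Proof.
rewrite /derive; apply/cvg_lim; first exact: norm_hausdorff.
have dcvg : den (k *: w) @[k --> (0 : (R[i] : numFieldType))^'] --> E^-1.
  rewrite -[X in _ --> X]addr0; apply: cvgD; first exact: cvg_cst.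
  rewrite -[X in _ --> X](mulr0 (E^-1 * star z)).
  apply: cvg_mul; first exact: cvg_cst.
  rewrite -(scale0r w); apply: cvgZl; exact: nbhs_dnbhs.
have uE' : E^-1 \is a GRing.unit by rewrite unitrV.
have [du dv] := cvg_inv uE' dcvg; rewrite invrK in dv.
have H : D * w * (den (k *: w))^-1 @[k --> (0 : (R[i] : numFieldType))^'] --> D * w * E.
  by apply: cvg_mul => //; exact: cvg_cst.
apply: cvg_trans H; apply: near_eq_cvg; near=> k.
have k0 : k != 0 by near: k; exact: nbhs_dnbhs_neq.
rewrite /= addr0 moebius_transvec0 moebius_transvecB; last by near: k.
by rewrite -scalerAr -scalerAl scalerA mulVf// scale1r.
Unshelve. all: by end_near. Qed.

End Point.

Lemma Finsler_defect (F : A -> A -> R) (hF : is_invariant_Finsler F) z v : ball1 z ->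
  F z v = rnorm ((defect (star z))^-1 * v * (defect z)^-1).
Proof.
move=> z1; set w := _ * v * _.
have b0 : ball1 (0 : A) by rewrite /ball1/= rnorm0.
case: hF => F0 /(_ (transvec z) 0 w (transvec_Utheta z1) b0).
rewrite F0 moebius_transvec0// derive_moebius_transvec// => <-; congr (F _ _).
by rewrite /w !mulrA mulrV ?mul1r ?mulrVK//; apply: defect_unit => //; exact: ball1_star.
Qed.

End Moebius.

(** Regroupings for [rnorm_translate_le], where [u] is the multiple of [star z * z] moved from one
    positive summand to the other. *)
Lemma shift_sub (V : zmodType) (s t a w u : V) :
  s + t - (a + w) = (s - u - w) + (t - (a - u)).
Proof.
rewrite opprB [s - u - w]addrAC [t + (u - a)]addrCA (addrA (s - w - u)) subrK.
by rewrite opprD [- a - w]addrC addrACA.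
Qed.

Lemma shift_add (V : zmodType) (s t a w u : V) :
  s + t + (a + w) = (s - u + w) + (t + (a + u)).
Proof.
rewrite [a + u]addrC [s - u + w]addrAC [t + (u + a)]addrCA (addrA (s + w - u)) subrK.
by rewrite [a + w]addrC addrACA.
Qed.

(** * Growth of the norm along a tangent vector *)

Section Growth.
Local Open Scope complex_scope.
Context {R : realType} {A : unitalCstarAlg R}.
Implicit Types (a b u v w x y z : A) (t k e h : R).

Lemma pos_conj b x : star b = b -> pos x -> pos (b * x * b).
Proof.
move=> sb /pos_sqrt[u [[su _] <- _]].
have -> : b * (u * u) * b = star (u * b) * (u * b) by rewrite starM su sb !mulrA.
exact: pos_star_mul.
Qed.

(* With [v = D y E] the cross terms of [(z + h v)^* (z + h v)] are [h E q E] where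
   [q = z^* y + y^* z] has norm at most [2 |z| |y|], and [E^2 = 1 - z^* z]. *)
Lemma rnorm_translate_le z y v h : ball1 z -> 0 <= h ->
  2 * h * rnorm z * rnorm y <= 1 ->
  v = defect (star z) * y * defect z ->
  rnorm (z + h%:C *: v) ^+ 2 <=
    rnorm z ^+ 2 + 2 * h * rnorm z * rnorm y * (1 - rnorm z ^+ 2) + h ^+ 2 * rnorm v ^+ 2.
Proof.
move=> z1 h0 hk vE; set r := rnorm z in hk *; set k := rnorm y in hk *.
set E := defect z in vE *; set D := defect (star z) in vE *.
have r0 : 0 <= r := rnorm_ge0 z; have k0 : 0 <= k := rnorm_ge0 y.
have r1 : r < 1 := z1.
have sE : star E = E by exact: star_defect.
have sD : star D = D by apply: star_defect; exact: ball1_star.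
have zD : star z * D = E * star z.
  by rewrite /D defect_intertwine ?starK//; exact: ball1_star.
have Dz : D * z = z * E by rewrite defect_intertwine.
pose a := star z * z; have EE : E * E = 1 - a by exact: defect_sqr.
clearbody D E.
pose q := star z * y + star y * z.
have sq : star q = q by rewrite starD !starM !starK addrC.
have nq : rnorm q <= 2 * r * k.
  apply: le_trans (rnormD _ _) _.
  have := rnormM (star z) y; have := rnormM (star y) z.
  by rewrite !rnorm_star -/r -/k; lra.
pose X := a + h%:C *: (E * q * E).
have -> : rnorm (z + h%:C *: v) ^+ 2 = rnorm (X + (h ^+ 2)%:C *: (star v * v)).
  rewrite -rnormE; congr rnorm.
  have zv : star z * v = E * (star z * y) * E.
    by rewrite vE !mulrA zD.
  have vz : star v * z = E * (star y * z) * E.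
    by rewrite vE !starM sE sD -!mulrA Dz.
  rewrite starD starZr mulrDl !mulrDr -!scalerAl -!scalerAr zv vz scalerA.
  rewrite -rmorphM -expr2 addrA; congr (_ + _).
  by rewrite /X -addrA; congr (_ + _); rewrite -scalerDr -mulrDl -mulrDr.
apply: le_trans (rnormD _ _) _; apply: lerD; last first.
  by rewrite rnormZr rnormE ger0_norm// sqr_ge0.
pose m := 2 * h * r * k.
have m0 : 0 <= m by rewrite /m !mulr_ge0.
have qE : forall x : A, h%:C *: (E * (sc (2 * r * k) + x) * E) =
    sc m - m%:C *: a + h%:C *: (E * x * E).
  move=> x; rewrite mulrDr mulrDl scalerDr; congr (_ + _).
  rewrite mul_sc -scalerAl scalerA -rmorphM EE scalerBr; congr (_ - _ *: _).
    by rewrite /sc /m !mulrA (mulrC h).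
  by rewrite /m !mulrA (mulrC h).
have pE x : pos (sc (2 * r * k) + x) -> pos (sc m - m%:C *: a + h%:C *: (E * x * E)).
  by move=> px; rewrite -qE; apply: posZ => //; exact: pos_conj.
have pa : pos a by exact: pos_star_mul.
have na : rnorm a = r ^+ 2 by rewrite rnormE.
have -> : r ^+ 2 + 2 * h * r * k * (1 - r ^+ 2) = m + (1 - m) * r ^+ 2.
  by rewrite /m; ring.
have m1 : 0 <= 1 - m by rewrite subr_ge0.
have s1 : (1 - m)%:C *: sc (r ^+ 2) = sc ((1 - m) * r ^+ 2) :> A by rewrite [RHS]scM sc_mul.
(* Since [h q] has norm at most [m], both [m E^2 - h E q E] and [m E^2 + h E q E] are positive, with
   [E^2 = 1 - a]. What remains is [(1 - m) (r^2 - a)] from above, where [m <= 1] matters, and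
   [(1 - m) r^2 + (1 + m) a] from below. *)
apply: pos_rnorm_sandwich.
- by rewrite addr_ge0// mulr_ge0// sqr_ge0.
- have -> : sc (m + (1 - m) * r ^+ 2) - X =
      (sc m - m%:C *: a + h%:C *: (E * (- q) * E)) + (1 - m)%:C *: (sc (r ^+ 2) - a).
    rewrite mulrN mulNr scalerN scalerBr s1 rmorphB scalerBl rmorph1 scale1r.
    by rewrite /X scD; exact: shift_sub.
  apply: posD; first by apply: pE; apply: pos_scB.
  by apply: posZ => //; apply: pos_scB; [case: pa|rewrite na].
- have -> : sc (m + (1 - m) * r ^+ 2) + X =
      (sc m - m%:C *: a + h%:C *: (E * q * E)) + (sc ((1 - m) * r ^+ 2) + (1 + m)%:C *: a).
    rewrite rmorphD scalerDl rmorph1 scale1r /X scD.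
    exact: shift_add.
  apply: posD; first apply: pE.
    by rewrite -[q]opprK; apply: pos_scB; rewrite ?rnormN// starN sq.
  apply: posD; first by apply: pos_sc; rewrite mulr_ge0// sqr_ge0.
  by apply: posZ => //; rewrite addr_ge0.
Qed.

End Growth.

Section GrowthNear.
Local Open Scope complex_scope.
Context {R : realType} {A : unitalCstarAlg R}.
Implicit Types (a b u v w x y z : A) (t k e h : R).

Lemma rnorm_defect_le1 z : ball1 z -> rnorm (defect z) <= 1.
Proof.
move=> z1; rewrite -(@expr_le1 _ 2)// ?rnorm_ge0//.
by rewrite -rnorm_sqr_sa ?star_defect// defect_sqr// star_mul_bound// ltW.
Qed.

Lemma rnorm_translate_near z y v : ball1 z ->
  v = defect (star z) * y * defect z -> exists c d : R, [/\ 0 <= c, 0 < d &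
  forall h, 0 <= h <= d -> rnorm (z + h%:C *: v) <=
    rnorm z + h * ((1 - rnorm z ^+ 2) * rnorm y) + c * h ^+ 2].
Proof.
move=> z1 vE; have := fun h H1 H2 => @rnorm_translate_le _ _ z y v h z1 H1 H2 vE.
set r := rnorm z; set k := rnorm y; set m := rnorm v => H.
have r0 : 0 <= r := rnorm_ge0 z; have k0 : 0 <= k := rnorm_ge0 y.
have m0 : 0 <= m := rnorm_ge0 v; have r1 : r < 1 := z1.
(* Extracting the root to first order needs [r > 0]. At [r = 0] the bound is [h] times the norm of
   [v], and [v] is no longer than [y] because both defects are contractions. *)
have [rz|rN0] := eqVneq r 0.
  exists 0, 1; split=> // h /andP[h0 h1].
  rewrite mul0r addr0 rz add0r expr0n subr0 mul1r.
  have hm : rnorm (z + h%:C *: v) <= h * m.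
    rewrite -(@ler_pXn2r _ 2)// ?nnegrE ?rnorm_ge0 ?mulr_ge0//.
    have := H h h0; rewrite rz expr0n/= !(mulr0, mul0r, add0r) exprMn; apply.
    exact: ler01.
  apply: le_trans hm _; rewrite ler_wpM2l// /m vE.
  apply: le_trans (rnormM _ _) _; rewrite -[leRHS]mulr1.
  apply: ler_pM; rewrite ?rnorm_ge0 ?rnorm_defect_le1//.
  apply: le_trans (rnormM _ _) _; rewrite -[leRHS]mul1r.
  by apply: ler_pM; rewrite ?rnorm_ge0 ?rnorm_defect_le1//; exact: ball1_star.
have rp : 0 < r by rewrite lt_def rN0.
have d0 : 0 < 2 * r * k + 1 by have := mulr_ge0 r0 k0; lra.
(* With this [c], the cross term [2 r c h^2] in the square of the right side equals [h^2 m^2]; [d]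
   guarantees [2 h r k <= 1]. *)
exists (m ^+ 2 / (2 * r)), (2 * r * k + 1)^-1; split.
- by rewrite divr_ge0 ?sqr_ge0// mulr_ge0.
- by rewrite invr_gt0.
move=> h /andP[h0 hd].
have h1 : h * (2 * r * k + 1) <= 1 by rewrite -ler_pdivlMr// div1r.
have {}H : rnorm (z + h%:C *: v) ^+ 2 <= r ^+ 2 + 2 * h * r * k * (1 - r ^+ 2) + h ^+ 2 * m ^+ 2.
  by apply: H => //; lra.
set c := m ^+ 2 / (2 * r); have cE : m ^+ 2 = 2 * r * c.
  by rewrite /c mulrC divfK// mulf_neq0// lt0r_neq0.
have c0 : 0 <= c by rewrite divr_ge0 ?sqr_ge0// mulr_ge0.
have r2 : 0 <= 1 - r ^+ 2 by nra.
have p0 : 0 <= (1 - r ^+ 2) * k by rewrite mulr_ge0.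
set p := (1 - r ^+ 2) * k in p0 *.
have hp : 0 <= h * p by rewrite mulr_ge0.
have hc : 0 <= c * h ^+ 2 by rewrite mulr_ge0 ?sqr_ge0.
rewrite -(@ler_pXn2r _ 2)// ?nnegrE ?rnorm_ge0//; last by rewrite !addr_ge0.
apply: le_trans H _; rewrite cE.
have -> : 2 * h * r * k * (1 - r ^+ 2) = 2 * r * (h * p) by rewrite /p; ring.
have -> : h ^+ 2 * (2 * r * c) = 2 * r * (c * h ^+ 2) by ring.
have := sqr_ge0 (h * p + c * h ^+ 2); set X := h * p; set Y := c * h ^+ 2; nra.
Qed.

End GrowthNear.

(** * Lengths of curves *)

Section RealLemmas.
Context {R : realType}.
Implicit Types (a b x r s t h e : R).

Definition artanh x := 2^-1 * ln ((1 + x) / (1 - x)).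

Lemma is_derive_artanh x : -1 < x < 1 -> is_derive x 1 artanh (1 - x ^+ 2)^-1.
Proof.
move=> /andP[xN1 x1].
pose g (y : R) := 2^-1 * (ln (1 + y) - ln (1 - y)).
have y1 : 0 < 1 + x by lra. have y2 : 0 < 1 - x by lra.
have : is_derive x 1 g (1 - x ^+ 2)^-1.
  have h1 : is_derive (1 - x) 1 (@ln R) (1 - x)^-1 by exact: is_derive1_ln.
  have h2 : is_derive x 1 (fun y => 1 - y) (-1 : R).
    by rewrite -[-1]add0r; exact: (is_deriveB (is_derive_cst (1 : R) x 1) (is_derive_id x 1)).
  have h3 := @is_derive1_comp _ (@ln R) (fun y => 1 - y) x _ _ h1 h2.
  have h4 : is_derive (1 + x) 1 (@ln R) (1 + x)^-1 by exact: is_derive1_ln.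
  have h5 : is_derive x 1 (fun y => 1 + y) (1 : R).
    by rewrite -[X in is_derive _ _ _ X]add0r; exact: (is_deriveD (is_derive_cst (1 : R) x 1) (is_derive_id x 1)).
  have h6 := @is_derive1_comp _ (@ln R) (fun y => 1 + y) x _ _ h4 h5.
  have h7 := is_deriveZ 2^-1 (is_deriveB h6 h3).
  apply: (is_derive_eq h7).
  rewrite /GRing.scale/=; field.
  by rewrite !lt0r_neq0//; nra.
apply: near_eq_is_derive.
near=> y.
have yN1 : -1 < y by near: y; exact: lt_nbhsr.
have yl1 : y < 1 by near: y; exact: lt_nbhsl.
have p1 : 0 < 1 + y by lra. have p2 : 0 < 1 - y by lra.
by rewrite /g /artanh lnM ?posrE ?invr_gt0// lnV.
Unshelve. all: by end_near. Qed.

Lemma artanh_le x t : 0 <= x -> x <= t -> t < 1 -> artanh x <= artanh t.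
Proof.
move=> x0 xt t1; rewrite /artanh ler_wpM2l// ler_ln ?posrE ?divr_gt0//; try lra.
by rewrite ler_pdivrMr; [rewrite mulrAC ler_pdivlMr; nra|lra].
Qed.

End RealLemmas.

Section Comparison.
Context {R : realType}.
Implicit Types (x y r s t h e : R) (f g phi : R -> R).
Notation mu := (@lebesgue_measure R).

Lemma is_derive_near f x df : is_derive x 1 f df -> forall e, 0 < e ->
  \forall h \near 0, `|f (x + h) - f x - h * df| <= e * `|h|.
Proof.
move=> [fx <-] e e0.
have /cvgrPdist_le/(_ _ e0) := fx.
rewrite near_withinE; apply: filterS => h hP.
have [->|hN0] := eqVneq h 0.
  by rewrite addr0 subrr mul0r subrr normr0 mulr0.
have := hP hN0; rewrite -/(derive f x 1) /= distrC /GRing.scale/= mulr1 addrC => H.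
have h0 : 0 < `|h| by rewrite normr_gt0.
rewrite -ler_pdivrMr// -normfV -normrM.
have -> // : (f (x + h) - f x - h * 'D_1 f x) / h = h^-1 * (f (x + h) - f x) - 'D_1 f x.
by field.
by move: H; rewrite addrC [h + x]addrC.
Qed.

(** The slope [s = (1 - r^2) (k + e / 2)] leaves room twice: strictly above [(1 - r^2) k] for errors
    of the curve, and [e / 2] below the target for the error of linearizing [artanh]. *)
Lemma artanh_slope r k e : 0 <= r < 1 -> 0 <= k -> 0 < e ->
  exists2 s, (1 - r ^+ 2) * k < s & \forall h \near 0^'+,
    r + h * s < 1 /\ artanh (r + h * s) <= artanh r + h * (k + e).
Proof.
move=> /andP[r0 r1] k0 e0; have r2 : 0 < 1 - r ^+ 2 by nra.
pose s := (1 - r ^+ 2) * (k + e / 2).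
have s0 : 0 < s by rewrite mulr_gt0//; lra.
exists s; first by rewrite ltr_pM2l//; lra.
have hr : -1 < r < 1 by lra.
have D := is_derive_artanh hr.
have s1 : 0 < s + 1 by lra.
have eta0 : 0 < e / 2 / (s + 1) by rewrite !divr_gt0.
have /nbhs_ballP[d /= d0 Hd] := is_derive_near D eta0.
have d1 : 0 < d / (s + 1) by rewrite divr_gt0.
have d2 : 0 < (1 - r) / (s + 1) by rewrite divr_gt0//; lra.
near=> h.
have h0 : 0 < h by [].
have hd : h < d / (s + 1) by near: h; exact: nbhs_right_lt.
have hd2 : h < (1 - r) / (s + 1) by near: h; exact: nbhs_right_lt.
move: hd hd2; rewrite !ltr_pdivlMr// => hd hd2.
have hs : 0 < h * s by rewrite mulr_gt0.
split; first by nra.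
have /Hd : ball 0 d (h * s) by rewrite /ball/= sub0r normrN gtr0_norm//; nra.
rewrite (gtr0_norm hs) ler_norml => /andP[_].
have -> : h * s * (1 - r ^+ 2)^-1 = h * (k + e / 2).
  by rewrite /s; field; rewrite lt0r_neq0.
have es : e / 2 / (s + 1) * (h * s) <= e / 2 * h.
  rewrite mulrAC ler_pdivrMr//; have : 0 <= e / 2 * h by rewrite mulr_ge0//; lra.
  by nra.
by lra.
Unshelve. all: by end_near. Qed.

Lemma within_continuous_eps f a b : {within `[a, b], continuous f} ->
  forall x, a <= x <= b -> forall e, 0 < e -> exists2 d, 0 < d &
  forall y, a <= y <= b -> `|y - x| < d -> `|f y - f x| < e.
Proof.
move=> /subspace_continuousP cf x xab e e0.
have /cf/cvgrPdist_lt/(_ _ e0) : `[a, b]%classic x by rewrite /= in_itv.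
rewrite near_withinE => /nbhs_ballP[d /= d0 H]; exists d => // y yab yx.
rewrite distrC; apply: H; first by rewrite /ball/= distrC.
by rewrite /= in_itv.
Qed.

Lemma dini_nondecreasing f a b : a < b -> {within `[a, b], continuous f} ->
  (forall x, a < x < b -> forall e, 0 < e ->
    \forall h \near 0^'+, f x <= f (x + h) + e * h) ->
  f a <= f b.
Proof.
move=> ab cf df.
(* The condition is only given in the interior, so the argument starts at [c > a], and continuity at
   [a] concludes. The supremum of [S] is in [S] by continuity, and the condition there would push it
   further unless it is [b]. *)
have H c e : a < c < b -> 0 < e -> f c <= f b + e * (b - c).
  move=> /andP[ac cb] e0.
  pose S := [set x | c <= x <= b /\ f c <= f x + e * (x - c)].
  have Sc : S c by split; [rewrite lexx ltW|rewrite subrr mulr0 addr0].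
  have Sb : ubound S b by move=> x [/andP[]].
  have hS : has_sup S by split; [exists c|exists b].
  set m := sup S.
  have cm : c <= m by apply: ub_le_sup => //; exists b.
  have mb : m <= b by apply: ge_sup => //; exists c.
  have mab : a <= m <= b by rewrite mb andbT; lra.
  have Sm : S m.
    split; first by rewrite cm.
    rewrite leNgt; apply/negP => lt.
    set g := f c - (f m + e * (m - c)).
    have g0 : 0 < g by rewrite /g; lra.
    have g2 : 0 < g / 2 by lra.
    have [d d0 Hd] := within_continuous_eps cf mab g2.
    have [x [/andP[cx xb] fx]] := sup_adherent d0 hS; rewrite -/m => mx.
    have xm : x <= m by apply: ub_le_sup => //; [exists b|split=> //; rewrite cx].
    have xab : a <= x <= b by lra.
    have xd : `|x - m| < d by rewrite ler0_norm; lra.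
    have := Hd x xab xd; rewrite ltr_norml => /andP[_].
    have : e * (x - c) <= e * (m - c) by rewrite ler_pM2l//; lra.
    by move: fx; rewrite /g; lra.
  have [mltb|mgeb] := ltP m b; last first.
    have {}mb : m = b by lra.
    by case: Sm; rewrite mb.
  exfalso.
  have mab' : a < m < b by lra.
  have Hm := df m mab' e e0.
  have bm0 : 0 < b - m by lra.
  near (0:R)^'+ => h.
  have h0 : 0 < h by [].
  have hb : h < b - m by near: h; exact: nbhs_right_lt.
  have fh : f m <= f (m + h) + e * h by near: h.
  have : S (m + h).
    split; first lra.
    by case: Sm => _; move: fh; lra.
  move=> /(ub_le_sup (ex_intro _ b Sb)); rewrite -/m; lra.
apply/ler_addgt0Pr => e e0.
have aab : a <= a <= b by lra.
have e2 : 0 < e / 2 by lra.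
have [d d0 Hd] := within_continuous_eps cf aab e2.
have ba : 0 < b - a by lra.
have e3 : 0 < e / 2 / (b - a) by rewrite divr_gt0.
near a^'+ => c.
have ac : a < c by [].
have cb : c < b by near: c; exact: nbhs_right_lt.
have cd : c < a + d by near: c; apply: nbhs_right_lt; lra.
have cab : a < c < b by rewrite ac.
have cab' : a <= c <= b by lra.
have acd : `|c - a| < d by rewrite gtr0_norm; lra.
have := Hd c cab' acd; rewrite ltr_norml => /andP[h1 h2].
have := H c _ cab e3.
have : e / 2 / (b - a) * (b - c) <= e / 2.
  by rewrite mulrAC ler_pdivrMr// ler_pM2l//; lra.
lra.
Unshelve. all: by end_near. Qed.

(** For a primitive [G] of [phi], the difference [G - f] satisfies the one-sided condition of
    [dini_nondecreasing]; no derivative of [f] is needed. *)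
Lemma growth_le_integral f phi a b : a < b ->
  {within `[a, b], continuous f} -> {within `[a, b], continuous phi} ->
  (forall x, a < x < b -> forall e, 0 < e ->
    \forall h \near 0^'+, f (x + h) <= f x + h * (phi x + e)) ->
  ((f b - f a)%:E <= \int[mu]_(t in `[a, b]) (phi t)%:E)%E.
Proof.
move=> ab cf cphi fphi.
have iphi : mu.-integrable `[a, b] (EFin \o phi).
  by apply: continuous_compact_integrable => //; exact: segment_compact.
pose G x := parameterized_integral mu a x phi.
have cG : {within `[a, b], continuous G}.
  by apply: parameterized_integral_continuous => //; exact: ltW.
have Ga : G a = 0 by rewrite /G /parameterized_integral set_itv1 Rintegral_set1.
have Gb : (\int[mu]_(t in `[a, b]) (phi t)%:E = (G b)%:E)%E.
  by rewrite /G /parameterized_integral /Rintegral fineK//; exact: integrable_fin_num.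
rewrite Gb lee_fin.
suff : (G \- f) a <= (G \- f) b by rewrite /= Ga; lra.
apply: dini_nondecreasing => //.
  move/subspace_continuousP: cG => cG; move/subspace_continuousP: cf => cf.
  by apply/subspace_continuousP => x xab; apply: cvgB; [exact: cG|exact: cf].
move=> x /andP[ax xb] e e0.
have cx : {for x, continuous phi}.
  by apply: (within_continuous_continuous ab cphi); rewrite in_itv/= ax.
have [dG GE] := continuous_FTC1_closed xb iphi ax cx.
have e2 : 0 < e / 2 by lra.
have DG : is_derive x 1 G (phi x).
  by split; [exact: dG|rewrite -derive1E GE].
have /nbhs_ballP[d /= d0 Hd] := is_derive_near DG e2.
have xab : a < x < b by rewrite ax.
have Hf := fphi x xab _ e2.
near=> h.
have h0 : 0 < h by [].
have hd : h < d by near: h; exact: nbhs_right_lt.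
have : f (x + h) <= f x + h * (phi x + e / 2) by near: h.
have /Hd : ball 0 d h by rewrite /ball/= sub0r normrN gtr0_norm.
rewrite (gtr0_norm h0) ler_norml => /andP[h1 _] h2.
rewrite /=; lra.
Unshelve. all: by end_near. Qed.

End Comparison.

(** * Lower bound for the length of a curve *)

Section CurveLength.
Local Open Scope complex_scope.
Context {R : realType} {A : unitalCstarAlg R}.
Context (F : A -> A -> R) (hF : is_invariant_Finsler F).
Implicit Types (a b e h t s : R) (z w v : A) (gamma : R -> A).
Notation mu := (@lebesgue_measure R).

Lemma Finsler_ge0 z v : ball1 z -> 0 <= F z v.
Proof. by move=> z1; rewrite (Finsler_defect hF)// rnorm_ge0. Qed.

(** The value of [F] on the ball by [Finsler_defect], in a form whose continuity in both arguments
    can be proved. *)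
Definition speed z v : R := rnorm ((defect (star z))^-1 * v * (defect z)^-1).

Lemma near_right_dnbhs (P : R -> Prop) :
  (\forall h \near 0^', P h) -> \forall h \near 0^'+, P h.
Proof.
rewrite !near_withinE; apply: filterS => h + h0; apply.
by rewrite gt_eqF.
Qed.

Lemma cvg_speed {T : Type} (G : set_system T) {FG : Filter G} (f g : T -> A) z v :
  (\forall t \near G, ball1 (f t)) -> ball1 z ->
  f t @[t --> G] --> z -> g t @[t --> G] --> v ->
  speed (f t) (g t) @[t --> G] --> speed z v.
Proof.
move=> fb zb fz gv; apply: cvg_rnorm; apply: cvg_mul.
  apply: cvg_mul => //.
  apply: (cvg_inv (defect_unit (ball1_star zb)) _).2; apply: cvg_sqrt1m.
  - by apply: filterS fb => t /ball1_star/star_mul_le1/ltW.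
  - exact/ltW/star_mul_le1/ball1_star.
  - by rewrite starK; under eq_fun do rewrite starK; apply: cvg_mul => //; exact: cvg_star.
apply: (cvg_inv (defect_unit zb) _).2; apply: cvg_sqrt1m.
- by apply: filterS fb => t /star_mul_le1/ltW.
- exact/ltW/star_mul_le1.
- by apply: cvg_mul => //; exact: cvg_star.
Qed.

Lemma artanh_rnorm_growth gamma t v e : ball1 (gamma t) -> 0 < e ->
  diff_quot gamma t h @[h --> 0^'] --> v ->
  \forall h \near 0^'+, artanh (rnorm (gamma (t + h))) <=
    artanh (rnorm (gamma t)) + h * (speed (gamma t) v + e).
Proof.
move=> gb e0 gv; set z := gamma t in gb *; set r := rnorm z.
have uE := defect_unit gb; have uD := defect_unit (ball1_star gb).
set y := (defect (star z))^-1 * v * (defect z)^-1.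
have vE : v = defect (star z) * y * defect z by rewrite /y !mulrA mulrV// mul1r mulrVK.
rewrite -[speed z v]/(rnorm y).
have [c [d [c0 d0 H]]] := rnorm_translate_near gb vE.
have r01 : 0 <= r < 1 by rewrite rnorm_ge0.
have [s s0 Hs] := artanh_slope r01 (rnorm_ge0 y) e0.
rewrite -/r in H.
set p := (1 - r ^+ 2) * rnorm y in s0 H.
(* Half of the gap [s - p] absorbs the error of the difference quotient, the other half the term
   [c h^2]. *)
have eta0 : 0 < (s - p) / 2 by lra.
have Hq : \forall h \near 0^'+, rnorm (diff_quot gamma t h - v) < (s - p) / 2.
  by apply: near_right_dnbhs; move/cvg_rnormP: gv; exact.
have c1 : 0 < c + 1 by lra.
have d2 : 0 < (s - p) / 2 / (c + 1) by rewrite divr_gt0.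
near=> h.
have h0 : 0 < h by [].
have hd : h <= d by near: h; exact: nbhs_right_le.
have hd2 : h <= (s - p) / 2 / (c + 1) by near: h; exact: nbhs_right_le.
move: hd2; rewrite ler_pdivlMr// => hd2.
have [hs1 hs2] : r + h * s < 1 /\ artanh (r + h * s) <= artanh r + h * (rnorm y + e).
  by near: h.
apply: le_trans hs2; apply: artanh_le => //; first exact: rnorm_ge0.
have hq : rnorm (diff_quot gamma t h - v) < (s - p) / 2 by near: h.
have -> : gamma (t + h) = (z + h%:C *: v) + h%:C *: (diff_quot gamma t h - v).
  rewrite scalerBr /diff_quot scalerA -rmorphM mulfV ?gt_eqF// rmorph1 scale1r.
  by rewrite -/z -addrA [h%:C *: v + _]addrC subrK addrC subrK.
apply: le_trans (rnormD _ _) _; rewrite rnormZr gtr0_norm//.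
have h0d : 0 <= h <= d by rewrite ltW.
have := H h h0d.
have : h * rnorm (diff_quot gamma t h - v) <= h * ((s - p) / 2).
  by rewrite ler_pM2l// ltW.
have : c * h ^+ 2 <= h * ((s - p) / 2) by nra.
lra.
Unshelve. all: by end_near. Qed.

(** The extension [w] of the derivative makes the speed continuous up to the end points, where
    [velocity] is uncontrolled; these are negligible for the integral. *)
Lemma C1_on_speed a b gamma : a < b -> C1_on a b gamma ->
  (forall t, a <= t <= b -> ball1 (gamma t)) ->
  exists2 phi : R -> R, {within `[a, b], continuous phi} &
    (forall t, a < t < b -> F (gamma t) (velocity gamma t) = phi t) /\
    ((artanh (rnorm (gamma b)) - artanh (rnorm (gamma a)))%:E <=
      \int[mu]_(t in `[a, b]) (phi t)%:E)%E.
Proof.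
move=> ab [cg [w [cw gw]]] gb.
exists (fun t => speed (gamma t) (w t)).
  apply/subspace_continuousP => x; rewrite /= in_itv/= => xab.
  move/subspace_continuousP/(_ x) : cg; rewrite /= in_itv/= => /(_ xab) cg.
  move/subspace_continuousP/(_ x) : cw; rewrite /= in_itv/= => /(_ xab) cw.
  apply: cvg_speed => //; last exact: gb.
  by rewrite near_withinE; apply: nearW => t; rewrite /= in_itv/= => /gb.
split.
  move=> t tab; have tab' : a <= t <= b by move/andP: tab => [/ltW -> /ltW ->].
  rewrite (Finsler_defect hF); last exact: gb.
  by congr (rnorm (_ * _ * _)); apply/cvg_lim; [exact: norm_hausdorff|exact: gw].
apply: (@growth_le_integral _ (fun t => artanh (rnorm (gamma t)))) => //.
- apply/subspace_continuousP => x; rewrite /= in_itv/= => xab.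
  move/subspace_continuousP/(_ x) : cg; rewrite /= in_itv/= => /(_ xab) cg.
  apply: (@continuous_cvg _ _ _ _ _ _ artanh); last exact: cvg_rnorm.
  apply: differentiable_continuous; apply/derivable1_diffP.
  have hr : -1 < rnorm (gamma x) < 1.
    have := rnorm_ge0 (gamma x); have : rnorm (gamma x) < 1 by exact: gb.
    by lra.
  by have [] := is_derive_artanh hr.
- apply/subspace_continuousP => x; rewrite /= in_itv/= => xab.
  move/subspace_continuousP/(_ x) : cg; rewrite /= in_itv/= => /(_ xab) cg.
  move/subspace_continuousP/(_ x) : cw; rewrite /= in_itv/= => /(_ xab) cw.
  apply: cvg_speed => //; last exact: gb.
  by rewrite near_withinE; apply: nearW => t; rewrite /= in_itv/= => /gb.
- move=> x xab e e0; apply: artanh_rnorm_growth => //; last exact: gw.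
  by apply: gb; move/andP: xab => [/ltW -> /ltW ->].
Qed.

(** Induction on the subdivision points, with telescoping increments of [artanh]. Measurability is
    carried along because splitting the integral requires it. *)
Lemma curve_length_lower z gamma : ball_curve 0 z gamma ->
  measurable_fun `[(0 : R), 1]
    (EFin \o (fun t => F (gamma t) (velocity gamma t))) /\
  ((artanh (rnorm z))%:E <= curve_length F gamma)%E.
Proof.
move=> [[n [t [t0 tn C1]]] g0 g1 gb].
have tmono i j : (i <= j)%N -> (j <= n)%N -> t i <= t j.
  move=> /subnKC <-; elim: (j - i)%N => [|k IH]; first by rewrite addn0.
  rewrite addnS => ikn; apply: le_trans (IH (ltnW ikn)) _.
  by have [/ltW] := C1 _ ikn.
have t_ge0 i : (i <= n)%N -> 0 <= t i by move=> ni; rewrite -t0 tmono.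
have t_le1 i : (i <= n)%N -> t i <= 1 by move=> ni; rewrite -tn tmono.
rewrite /curve_length; set f := EFin \o (fun t => F (gamma t) (velocity gamma t)).
have f0 s : 0 <= s <= 1 -> (0 <= f s)%E.
  by move=> /gb s1; rewrite lee_fin Finsler_ge0.
suff H i : (i <= n)%N -> measurable_fun `[(0 : R), t i] f /\
    ((artanh (rnorm (gamma (t i))))%:E <= \int[mu]_(s in `[0%R, t i]) f s)%E.
  by have := H n (leqnn n); rewrite tn g1.
elim: i => [|i IH] ni.
  rewrite t0 set_itv1; split; first exact: measurable_fun_set1.
  rewrite integral_set1 g0 rnorm0 /artanh addr0 subr0 divr1 ln1 mulr0.
  exact: lexx.
have [mf If] := IH (ltnW ni).
have [ti Ci] := C1 _ ni.
have ti0 := t_ge0 i (ltnW ni); have ti1 := t_le1 _ ni.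
have gbi s : t i <= s <= t i.+1 -> ball1 (gamma s).
  by move=> /andP[s0 s1]; apply: gb; rewrite (le_trans ti0)//= (le_trans s1).
have [phi cphi [fphi Iphi]] := C1_on_speed ti Ci gbi.
have mphi : measurable_fun `]t i, t i.+1[ (EFin \o phi).
  apply/measurable_EFinP; apply: (@measurable_funS _ _ _ _ `[t i, t i.+1]) => //.
    exact: subset_itv_oo_cc.
  exact: subspace_continuous_measurable_fun.
have moo : measurable_fun `]t i, t i.+1[ f.
  apply: eq_measurable_fun mphi => s; rewrite inE/= in_itv/= => sI.
  by rewrite /f/= fphi.
have moc : measurable_fun `]t i, t i.+1] f.
  rewrite -(@setUitv1 _ _ (BRight (t i)) (t i.+1) true)//; apply/measurable_funU => //.
  by split => //; exact: measurable_fun_set1.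
have U : `[(0 : R), t i.+1]%classic = `[(0 : R), t i] `|` `]t i, t i.+1].
  by rewrite -itv_bndbnd_setU// bnd_simp// ltW.
have mU : measurable_fun `[(0 : R), t i.+1] f.
  by rewrite U; apply/measurable_funU.
split => //.
have -> : (artanh (rnorm (gamma (t i.+1)))) = artanh (rnorm (gamma (t i))) +
    (artanh (rnorm (gamma (t i.+1))) - artanh (rnorm (gamma (t i)))) by rewrite subrKC.
rewrite U ge0_integral_setU//.
- rewrite EFinD; apply: leeD => //; apply: le_trans Iphi _.
  rewrite (integral_itv_bndoo _ _ mphi) (integral_itv_bndoo _ _ moo).
  rewrite le_eqVlt; apply/orP; left; apply/eqP/eq_integral => s; rewrite inE/= in_itv/= => sI.
  by rewrite /f/= fphi.
- by rewrite -U.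
- move=> s; rewrite -U /= in_itv/= => /andP[s0 s1]; apply: f0.
  by rewrite s0 (le_trans s1).
- apply/disj_setPLR => s /=; rewrite !in_itv/= => /andP[s0 s1] /andP[].
  by rewrite ltNge s1.
Qed.

End CurveLength.

(** * The radial segment *)

Section Segment.
Local Open Scope complex_scope.
Context {R : realType} {A : unitalCstarAlg R}.
Context (F : A -> A -> R) (hF : is_invariant_Finsler F).
Context (z : A) (hz : ball1 z).
Implicit Types (e h t s : R).
Notation mu := (@lebesgue_measure R).
Let r := rnorm z.
Let r0 : 0 <= r. Proof. exact: rnorm_ge0. Qed.
Let r1 : r < 1. Proof. exact: hz. Qed.

Definition segment t : A := t%:C *: z.

Lemma cvg_diff_quot_segment t : diff_quot segment t h @[h --> 0^'] --> z.
Proof.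
apply/cvg_rnormP => e e0; near=> h.
have hN0 : h != 0 by near: h; exact: nbhs_dnbhs_neq.
rewrite /diff_quot /segment -scalerBl -rmorphB addrAC subrr add0r.
by rewrite scalerA -rmorphM mulVf// rmorph1 scale1r subrr rnorm0.
Unshelve. all: by end_near. Qed.

Lemma segment_ball t : 0 <= t <= 1 -> ball1 (segment t).
Proof.
move=> /andP[t0 t1]; rewrite /ball1/= rnormZr ger0_norm//.
by rewrite (le_lt_trans _ r1)// ler_piMl.
Qed.

Lemma ball_curve_segment : ball_curve 0 z segment.
Proof.
split; last exact: segment_ball.
- exists 1%N, (fun i => i%:R); split=> // -[|//] _; split; first exact: ltr01.
  split.
    apply: continuous_subspaceT => t; apply/cvg_rnormP => e e0.
    have d0 : 0 < e / (r + 1) by rewrite divr_gt0//; have := r0; lra.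
    near=> s.
    rewrite /segment -scalerBl -rmorphB rnormZr -/r.
    have : `|s - t| < e / (r + 1).
      by rewrite distrC; near: s; apply: cvgr_dist_lt d0; exact: cvg_id.
    rewrite ltr_pdivlMr; last by have := r0; lra.
    by have := normr_ge0 (s - t); nra.
  exists (fun=> z); split; last by move=> u _; exact: cvg_diff_quot_segment.
  by apply: continuous_subspaceT => t; exact: cvg_cst.
- by rewrite /segment scale0r.
- by rewrite /segment rmorph1 scale1r.
Unshelve. all: by end_near. Qed.

Lemma velocity_segment t : velocity segment t = z.
Proof. by apply/cvg_lim; [exact: norm_hausdorff|exact: cvg_diff_quot_segment]. Qed.

(** As [w] is a real multiple of [z], the element [z] intertwines the defects of [w] and [star w],
    so the Finsler length is the norm of [z (1 - star w * w)^-1]; the Neumann series bounds it. *)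
Lemma Finsler_segment t : 0 <= t <= 1 -> F (segment t) z <= r / (1 - (t * r) ^+ 2).
Proof.
move=> t01; have bt := segment_ball t01.
rewrite (Finsler_defect hF)//; set w := segment t.
have uE := defect_unit bt; have uD := defect_unit (ball1_star bt).
have wz : z * defect w = defect (star w) * z.
  apply: sqrt1m_intertwine; last first.
  - by rewrite starK /w /segment starZr -!scalerAl -!scalerAr -!scalerAl mulrA.
  - exact/ltW/star_mul_le1/ball1_star.
  - exact/ltW/star_mul_le1.
rewrite -(intertwine_inv uE uD wz) -mulrA.
have -> : (defect w)^-1 * (defect w)^-1 = (1 - star w * w)^-1.
  rewrite -defect_sqr//; apply/esym/inv_mul2; first by rewrite mulrA mulrK// mulrV.
  by rewrite mulrA mulrVK// mulVr.
apply: le_trans (rnormM _ _) _; rewrite ler_wpM2l//.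
apply: le_trans (neumann (star_mul_le1 bt)).2 _.
rewrite rnormE rnormZr ger0_norm//; by case/andP: t01.
Qed.

Let tr t : 0 <= t <= 1 -> 0 <= t * r < 1.
Proof.
move=> /andP[t0 t1]; have := r1; rewrite mulr_ge0//= => h.
by rewrite (le_lt_trans _ h)// ler_piMl.
Qed.

Let poincare_speed_continuous :
  {within `[0, 1], continuous (fun t => r / (1 - (t * r) ^+ 2))}.
Proof.
apply: continuous_in_subspaceT => t; rewrite inE/= in_itv/= => /tr/andP[h1 h2].
have p0 : 1 - (t * r) ^+ 2 != 0 by rewrite lt0r_neq0//; nra.
apply: cvgM; first exact: cvg_cst.
apply: cvgV => //; apply: cvgB; first exact: cvg_cst.
by apply: cvgM; apply: cvgM; (exact: cvg_id || exact: cvg_cst).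
Qed.

Lemma integral_poincare_speed :
  (\int[mu]_(t in `[0%R, 1%R]) (r / (1 - (t * r) ^+ 2))%:E = (artanh r)%:E)%E.
Proof.
have D t : 0 <= t <= 1 ->
    is_derive t 1 (fun s => artanh (s * r)) (r / (1 - (t * r) ^+ 2)).
  move=> /tr/andP[h1 h2].
  have ha : -1 < t * r < 1 by lra.
  have D1 := is_derive_artanh ha.
  have D2 : is_derive t 1 (fun s => s * r) r.
    have := is_deriveM (is_derive_id t (1 : R)) (is_derive_cst r t 1).
    by move/is_derive_eq; apply; rewrite scaler0 add0r /GRing.scale/= mulr1.
  have := @is_derive1_comp _ (@artanh R) (fun s => s * r) t _ _ D1 D2.
  by move/is_derive_eq; apply; rewrite mulrC.
have C t : 0 <= t <= 1 -> {for t, continuous (fun s => artanh (s * r))}.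
  move=> /D[Dt _]; apply: differentiable_continuous.
  exact/derivable1_diffP.
have := @continuous_FTC2 R (fun t => r / (1 - (t * r) ^+ 2)) (fun s => artanh (s * r)) 0 1 ltr01.
have -> : artanh (0 * r) = 0 by rewrite mul0r /artanh addr0 subr0 divr1 ln1 mulr0.
rewrite mul1r sube0; apply.
- exact: poincare_speed_continuous.
- split.
  + move=> t; rewrite in_itv/= => /andP[t0 t1].
    by have [] : is_derive t 1 (fun s => artanh (s * r)) (r / (1 - (t * r) ^+ 2))
      by apply: D; rewrite !ltW.
  + by apply: cvg_at_right_filter; apply: C; rewrite lexx ler01.
  + by apply: cvg_at_left_filter; apply: C; rewrite lexx ler01.
- move=> t; rewrite in_itv/= => /andP[t0 t1]; rewrite derive1E.
  by have [_] : is_derive t 1 (fun s => artanh (s * r)) (r / (1 - (t * r) ^+ 2))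
    by apply: D; rewrite !ltW.
Qed.

Lemma curve_length_segment : (curve_length F segment <= (artanh r)%:E)%E.
Proof.
rewrite -integral_poincare_speed /curve_length.
have mf : measurable_fun `[(0 : R), 1] (fun t => r / (1 - (t * r) ^+ 2)).
  by apply: subspace_continuous_measurable_fun => //; exact: poincare_speed_continuous.
apply: ge0_le_integral => //.
- move=> t; rewrite /= in_itv/= => /segment_ball bt.
  by rewrite lee_fin (Finsler_ge0 hF).
- by have [] := curve_length_lower hF ball_curve_segment.
- exact/measurable_EFinP.
- move=> t; rewrite /= in_itv/= => t01.
  by rewrite lee_fin velocity_segment Finsler_segment.
Qed.

Lemma geodesic_dist_artanh : geodesic_dist F 0 z = (artanh r)%:E.
Proof.
apply/eqP; rewrite eq_le; apply/andP; split.
  apply: le_trans curve_length_segment; apply: ereal_inf_lbound.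
  by exists segment => //; exact: ball_curve_segment.
apply: le_ereal_inf_tmp => _ [gamma gc <-].
by have [] := curve_length_lower hF gc.
Qed.

End Segment.

Theorem theorem9p9 (R : realType) (A : unitalCstarAlg R)
  (F : A -> A -> R) (hF : is_invariant_Finsler F) (z : A) (hz : ball1 z) :
  ((2^-1)%R%:E * ell_opnorm z (log_endo z (cr0 z)) = geodesic_dist F 0%R z)%E.
Proof. by rewrite ell_opnorm_log// (geodesic_dist_artanh hF hz). Qed.
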